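(* For every real $p\geq 1$, every even integer $m\geq 4$, and every $n\in\mathbb{N}$ (with $n \ge 1$), every mapping $f:\mathbb{Z}_m^n\to L_1$ (where $L_1=L_1(\Omega,\mu)$ is any real or complex $L_1$ space over a measure space $(\Omega,\mu)$) satisfies $$\left(\sum_{j=1}^n\mathbb{E}_x\left\|f\left(x+\tfrac m2e_j\right)-f(x)\right\|_1^p\right)^{1/p}\leq\left(\frac{9\sqrt{210}}{16}\,m\,n^{(1/p-1/2)_+}+\frac94\,n^{1/p}\right)\left(\mathbb{E}_{x,\varepsilon}\|f(x+\varepsilon)-f(x)\|_1^p\right)^{1/p}.$$ Moreover, $$\frac{m^pn^{(1-p/2)_+}+n}{(2\pi)^p}\leq\mathsf{C}_p(m,n;L_1)\leq 11^p\left(m^pn^{(1-p/2)_+}+n\right).$$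
   Context: $\mathbb{Z}_m=\mathbb{Z}/m\mathbb{Z}$, and $e_1,\dots,e_n$ are the standard coordinate vectors of $\mathbb{Z}_m^n$. The variable $x$ is uniform on $\mathbb{Z}_m^n$, $\varepsilon$ is uniform on $\{-1,0,1\}^n$, and $x,\varepsilon$ are independent; $\mathbb{E}_x$ and $\mathbb{E}_{x,\varepsilon}$ are the corresponding expectations, and $x+\varepsilon$ is computed in $\mathbb{Z}_m^n$. $\|\cdot\|_1$ is the norm of $L_1(\Omega,\mu)$. $(a)_+=\max\{a,0\}$. For $1\le p<\infty$, even $m\ge 4$ and $n\in\mathbb{N}$, $$\mathsf{C}_p(m,n;L_1)=\sup_f\frac{\sum_{j=1}^n\mathbb{E}_x\|f(x+\frac m2e_j)-f(x)\|_1^p}{\mathbb{E}_{x,\varepsilon}\|f(x+\varepsilon)-f(x)\|_1^p},$$ where the supremum is over all real or complex $L_1(\Omega,\mu)$ spaces and all mappings $f:\mathbb{Z}_m^n\to L_1(\Omega,\mu)$ for which the denominator is nonzero. (Equivalently, it suffices to take the fixed range space $L_1[0,1]$.) *)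

(* Defs.v *)
From HB Require Import structures.
From mathcomp Require Export all_boot all_order all_algebra.
From mathcomp.real_closed Require Export complex.
From mathcomp Require Export all_classical all_reals all_analysis.

Set Implicit Arguments.
Unset Strict Implicit.
Unset Printing Implicit Defensive.

Import Order.TTheory GRing.Theory Num.Theory.
Import numFieldNormedType.Exports.

Local Open Scope classical_set_scope.
Local Open Scope ring_scope.

Section L1_spaces.
Context {d : measure_display} {T : measurableType d} {R : realType}.
Variable mu : {measure set T -> \bar R}.

(* Elements of L_1 are handled through their representatives. The real L_1
   space is the library's [Lfun mu 1]. *)
Definition L1norm (g : T -> R) : R := fine ('N[mu]_1[EFin \o g])%E.

Definition cmodulus (g : T -> R[i]) : T -> R :=
  fun t => ComplexField.Normc.normc (g t).

(* Borel measurability of a complex-valued function is measurability of its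
   real and imaginary parts. *)
Definition CLfun1 (g : T -> R[i]) : Prop :=
  [/\ measurable_fun setT (fun t => complex.Re (g t)),
      measurable_fun setT (fun t => complex.Im (g t)) &
      finite_norm mu 1%E (cmodulus g)].

Definition CL1norm (g : T -> R[i]) : R := L1norm (cmodulus g).

End L1_spaces.

Definition unif_mean {R : realType} (I : finType) (F : I -> R) : R :=
  (\sum_(i : I) F i) / #|I|%:R.

(* 'Z_m is Z/mZ only for m >= 2. *)
Notation torus m n := 'rV['Z_m]_n.

Definition half_shift (m n : nat) (j : 'I_n) : torus m n :=
  (m./2)%:R *: delta_mx 0 j.

(* The point e of {0,1,2}^n encodes the sign vector (e_j - 1)_j of
   {-1,0,1}^n, reduced modulo m. *)
Definition sign_shift (m n : nat) (e : {ffun 'I_n -> 'I_3}) : torus m n :=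
  \row_j ((e j : nat)%:R - 1).

Section cotype_functionals.
Context {R : realType} {V : zmodType}.
Variables (N : V -> R) (p : R) (m n : nat) (f : torus m n -> V).

Definition antipodal_sum : R :=
  \sum_(j < n) unif_mean (fun x : torus m n =>
    N (f (x + half_shift m j) - f x) `^ p).

Definition sign_mean : R :=
  unif_mean (fun xe : torus m n * {ffun 'I_n -> 'I_3} =>
    N (f (xe.1 + sign_shift m xe.2) - f xe.1) `^ p).

End cotype_functionals.

Definition real_cotype_ratios {R : realType} (p : R) (m n : nat) :
    set (\bar R) :=
  [set r | exists (d : measure_display) (T : measurableType d)
             (mu : {measure set T -> \bar R}) (f : torus m n -> T -> R),
     [/\ forall x, f x \in Lfun mu 1%E,
         sign_mean (L1norm mu) p f != 0 &
         r = (antipodal_sum (L1norm mu) p f /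
              sign_mean (L1norm mu) p f)%:E]].

Definition complex_cotype_ratios {R : realType} (p : R) (m n : nat) :
    set (\bar R) :=
  [set r | exists (d : measure_display) (T : measurableType d)
             (mu : {measure set T -> \bar R}) (f : torus m n -> T -> R[i]),
     [/\ forall x, CLfun1 mu (f x),
         sign_mean (CL1norm mu) p f != 0 &
         r = (antipodal_sum (CL1norm mu) p f /
              sign_mean (CL1norm mu) p f)%:E]].

Definition cotype_const_L1 {R : realType} (p : R) (m n : nat) : \bar R :=
  ereal_sup (real_cotype_ratios p m n `|` complex_cotype_ratios p m n).

(* Main.v *)
From mathcomp Require Import ring lra measurable_realfun.
Require Import Defs.
Import Order.TTheory GRing.Theory Num.Theory.
Import numFieldNormedType.Exports.
Local Open Scope classical_set_scope.
Local Open Scope ring_scope.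

Set Implicit Arguments.
Unset Strict Implicit.
Unset Printing Implicit Defensive.

(** Why the theorem is true.

    Let D(x) be the mean over the random sign vector of the distance from
    [f x] to [f (x + eps)].  The upper bound compares [f] with a nonlinear
    smoothing [h]: the value [h x] is the mean of the median of three
    independent samples of [f (x + eps)], taken pointwise on the measure space.

    Medians commute with superlevel sets, so by the layer-cake decomposition
    of a real function on a finite set everything about [h] reduces to the
    case where [f] is the indicator of a set.  There, if [a] is the
    probability that a random corner lies in the set, [h] equals
    [3 a^2 - 2 a^3].  Two facts about this polynomial are used.  It is at most
    [9/8 a], whence a distance at most [9/8 D] from [f] to [h]
    ([mean_med_dist]).  And it is flat at 0 and 1: freezing one coordinate of
    the sign vectors changes [a] to some [b <= 3 a], and the polynomial changes
    by at most [sqrt (18 a) |b - a|].  Bessel's inequality bounds the sum over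
    the coordinates of [(b - a)^2] by twice the variance [a (1 - a)], so the
    changes due to the [n] coordinates have Euclidean norm at most [6 a], and
    [6 (1 - a)] by symmetry, that is at most [6 D] on both sides of the cut
    ([sum_sqr_maj_prob_le]).  For a linear smoothing the bound would be of
    order [sqrt (a (1 - a))], which is not controlled by [D]; this gain is the reason
    for the median.  Minkowski's integral inequality carries the [6 D] bound
    first over the layers, then over the measure space.

    Freezing the [j]-th coordinate of eps at 1 around [x], or at 0 around
    [x + e_j], gives the same function.  A path of [m/2] unit steps from [x] to
    [x + (m/2) e_j] therefore costs [m] such half steps, plus two times [9/8 D]
    to enter and leave [h].  Comparing l_p and l_2 norms over the [n]
    coordinates gives the constant
    [6 m n^max(1/p - 1/2, 0) + 9/4 n^(1/p)] ([abstract_cotype]).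

    The argument only uses that the norm is [I |g|] for a positive linear
    functional [I] on a vector lattice of real functions.  The integral is one;
    for complex functions the modulus is approximated, with a ratio tending to
    one, by finite sums of absolute values of real linear forms, so the
    complex norm is a limit of functionals on a product of the measure space
    with a finite set ([complex_cotype]).

    For the lower bound, the indicator of the origin has ratio at least [n],
    and the map sending [x] to the Rademacher sum of the characters
    [exp (2 i pi x_j / m)], over all [j] if [p <= 2] and over a single [j] if
    [p >= 2], has ratio at least [(m / pi)^p n^max(1 - p/2, 0)]: the antipodal
    increments have norm 2, while by Cauchy-Schwarz the short ones are at most
    [2 pi / m] times the square root of the number of coordinates. *)

(** * Uniform means and real powers *)

Section UniformMeans.
Variable R : realType.
Implicit Types I J : finType.

Lemma mean_ge0 I (F : I -> R) : (forall i, 0 <= F i) -> 0 <= unif_mean F.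
Proof. by move=> F0; rewrite divr_ge0// sumr_ge0. Qed.

Lemma eq_mean I (F G : I -> R) : F =1 G -> unif_mean F = unif_mean G.
Proof. by move=> FG; congr (_ / _); apply: eq_bigr. Qed.

Lemma le_mean I (F G : I -> R) :
  (forall i, F i <= G i) -> unif_mean F <= unif_mean G.
Proof. by move=> FG; rewrite ler_wpM2r// ler_sum. Qed.

Lemma meanD I (F G : I -> R) :
  unif_mean (fun i => F i + G i) = unif_mean F + unif_mean G.
Proof. by rewrite /unif_mean big_split/= mulrDl. Qed.

Lemma meanZ I c (F : I -> R) :
  unif_mean (fun i => c * F i) = c * unif_mean F.
Proof. by rewrite /unif_mean -mulr_sumr mulrA. Qed.

Lemma mean_sum I (J : Type) (r : seq J) (P : pred J) (F : J -> I -> R) :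
  unif_mean (fun i => \sum_(j <- r | P j) F j i) =
  \sum_(j <- r | P j) unif_mean (F j).
Proof. by rewrite /unif_mean exchange_big/= mulr_suml. Qed.

Lemma mean_cst I (c : R) : (0 < #|I|)%N -> unif_mean (fun _ : I => c) = c.
Proof.
move=> I0; rewrite /unif_mean sumr_const -[c *+ _]mulr_natr mulfK//.
by rewrite pnatr_eq0 -lt0n.
Qed.

Lemma mean_reindex I J (h : J -> I) (F : I -> R) : bijective h ->
  unif_mean (F \o h) = unif_mean F.
Proof.
move=> bh; rewrite /unif_mean (bij_eq_card bh); congr (_ / _).
by rewrite (reindex h)//; exact: onW_bij.
Qed.

Lemma mean_pair I J (F : I * J -> R) :
  unif_mean F = unif_mean (fun i => unif_mean (fun j => F (i, j))).
Proof.
rewrite /unif_mean card_prod natrM invfM mulrA.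
rewrite (eq_bigr (fun i => F (i.1, i.2))); last by case.
rewrite -(pair_bigA _ (fun i j => F (i, j)))/= -mulrAC -mulr_suml.
by [].
Qed.

Lemma mean_translate (G : finZmodType) (g : G -> R) (y : G) :
  unif_mean (fun x => g (x + y)) = unif_mean g.
Proof.
apply: (mean_reindex (h := fun x => x + y)).
by exists (fun x => x - y) => x; rewrite ?addrK ?subrK.
Qed.

Lemma sum_unif_mean I F : (0 < #|I|)%N ->
  \sum_(i : I) F i = #|I|%:R * (unif_mean F : R).
Proof.
by move=> I0; rewrite /unif_mean mulrC divfK// pnatr_eq0 -lt0n.
Qed.

End UniformMeans.

Section Powers.
Variable R : realType.

(** The tangent to a convex power lies below its graph; in this form it is
    Young's inequality. *)
Lemma powR_tangent (p s v : R) : 1 <= p -> 0 <= s -> 0 <= v ->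
  s `^ p + p * s `^ (p - 1) * (v - s) <= v `^ p.
Proof.
move=> p1 s0 v0.
have p0 : 0 < p by lra.
have sp : s `^ (p - 1) * s = s `^ p.
  rewrite -{2}(powRr1 s0) -powRD; first by congr (_ `^ _); ring.
  by apply/implyP => /eqP; lra.
have [->|pn1] := eqVneq p 1; first by rewrite subrr !powRr1// powRr0; lra.
have p1' : 0 < p - 1 by rewrite subr_gt0 lt_neqAle eq_sym pn1.
have q0 : 0 < p / (p - 1) by rewrite divr_gt0.
have := @conjugate_powR R v (s `^ (p - 1)) p (p / (p - 1)) v0 (powR_ge0 _ _) p0 q0.
rewrite -powRrM mulrCA divff ?gt_eqF// mulr1 => H.
have {H} := H _.
have -> : p^-1 + (p / (p - 1))^-1 = 1 by field; rewrite !gt_eqF.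
move=> /(_ erefl) H.
have : p * (v * s `^ (p - 1)) <= v `^ p + s `^ p * (p - 1).
  rewrite -ler_pdivlMl// (le_trans H)// le_eqVlt; apply/orP; left; apply/eqP.
  by field; rewrite !gt_eqF.
rewrite (_ : p * _ * (v - s) = p * (v * s `^ (p - 1)) - p * s `^ p).
  by lra.
by rewrite -sp; ring.
Qed.

(** Summing the tangent inequality at the barycentre. *)
Lemma powR_jensen (I : finType) (p : R) (w v : I -> R) : 1 <= p ->
  (forall i, 0 <= w i) -> \sum_i w i = 1 -> (forall i, 0 <= v i) ->
  (\sum_i w i * v i) `^ p <= \sum_i w i * v i `^ p.
Proof.
move=> p1 w0 w1 v0; set s := \sum_i w i * v i.
have s0 : 0 <= s by apply: sumr_ge0 => i _; exact: mulr_ge0.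
apply: (@le_trans _ _
  (\sum_i w i * (s `^ p + p * s `^ (p - 1) * (v i - s)))); last first.
  by apply: ler_sum => i _; rewrite ler_wpM2l// powR_tangent.
under eq_bigr => i _.
  rewrite (_ : _ * _ = (s `^ p - p * s `^ (p - 1) * s) * w i
    + p * s `^ (p - 1) * (w i * v i)); last by ring.
  over.
by rewrite big_split/= -!mulr_sumr w1 -/s; lra.
Qed.

Lemma powR_mean (I : finType) (p : R) (v : I -> R) : 1 <= p ->
  (0 < #|I|)%N -> (forall i, 0 <= v i) ->
  unif_mean v `^ p <= unif_mean (fun i => v i `^ p).
Proof.
move=> p1 I0 v0; rewrite /unif_mean !mulr_suml.
under eq_bigr do rewrite mulrC.
under [leRHS]eq_bigr do rewrite mulrC.
apply: powR_jensen => //.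
  by rewrite sumr_const -[_ *+ _]mulr_natr mulVf// pnatr_eq0 -lt0n.
Qed.

(** For [p >= 2] the l_p norm is below the l_2 norm; for [p <= 2] the ratio of
    the two is at most the power of [n] that the vector of ones attains. *)
Lemma sum_powR_le (n : nat) (p D : R) (v : 'I_n -> R) : 1 <= p -> (0 < n)%N ->
  0 <= D -> (forall j, 0 <= v j) -> \sum_j v j ^+ 2 <= D ^+ 2 ->
  \sum_j v j `^ p <= n%:R `^ Num.max (1 - p / 2) 0 * D `^ p.
Proof.
move=> p1 n0 D0 v0 vD; case: (leP p 2) => p2.
  rewrite max_l; last by lra.
  (* Jensen for the exponent 2 / p applied to the p-th powers *)
  have p0 : 0 < p by lra.
  have nR : 0 < n%:R :> R by rewrite ltr0n.
  have := @powR_mean 'I_n (2 / p) (fun j => v j `^ p).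
  rewrite card_ord n0 => /(_ _ isT) H.
  have {H} := H _ (fun j => powR_ge0 _ _).
  rewrite ler_pdivlMr// mul1r => /(_ p2) H.
  have E j : (v j `^ p) `^ (2 / p) = v j ^+ 2.
    by rewrite -powRrM mulrCA divff ?gt_eqF// mulr1 powR_mulrn.
  rewrite (eq_mean E) in H.
  have M : unif_mean (fun j => v j `^ p) <= (D ^+ 2 / n%:R) `^ (p / 2).
    have M0 : 0 <= unif_mean (fun j => v j `^ p).
      by apply: mean_ge0 => j; exact: powR_ge0.
    have {1}-> : unif_mean (fun j => v j `^ p) =
        (unif_mean (fun j => v j `^ p) `^ (2 / p)) `^ (p / 2).
      rewrite -powRrM (_ : 2 / p * (p / 2) = 1) ?powRr1//.
      by field; rewrite gt_eqF.
    rewrite ge0_ler_powR ?nnegrE ?powR_ge0//; first by lra.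
      by rewrite divr_ge0// exprn_ge0.
    by rewrite (le_trans H)// /unif_mean card_ord ler_wpM2r.
  rewrite sum_unif_mean ?card_ord//.
  rewrite (le_trans (ler_wpM2l _ M))//.
  rewrite powRM ?exprn_ge0// ?invr_ge0// -powR_mulrn// -powRrM.
  rewrite [2 * _]mulrC divfK// mulrCA mulrC ler_wpM2r ?powR_ge0//.
  rewrite -powR_inv1 ?ler0n// -powRrM -{1}(powRr1 (ltW nR)) -powRD.
    by rewrite mulN1r.
  by apply/implyP => _; rewrite gt_eqF.
rewrite max_r ?powRr0 ?mul1r; last by lra.
(* each entry is at most D, so its p-th power is at most its square times
   D ^ (p - 2) *)
have vD1 j : v j <= D.
  rewrite -(ler_pXn2r (n:=2))// ?nnegrE// (le_trans _ vD)//.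
  by rewrite (bigD1 j)//= lerDl sumr_ge0// => i _; exact: exprn_ge0.
have pD x : 0 <= x -> x `^ p = x ^+ 2 * x `^ (p - 2).
  move=> x0; rewrite -powR_mulrn// -powRD; first by congr (_ `^ _); ring.
  by apply/implyP => /eqP; lra.
rewrite pD// (le_trans _ (ler_wpM2r (powR_ge0 _ _) vD))// mulr_suml.
apply: ler_sum => j _; rewrite pD// ler_wpM2l ?exprn_ge0//.
by rewrite ge0_ler_powR ?nnegrE//; lra.
Qed.

End Powers.

(** * Positive functionals *)

Section PositiveFunctionals.
Variable R : realType.

(** A Daniell integral without continuity: [E] is a vector lattice of functions
    on [Om] and [I] is linear and monotone on it.  Weighted finite sums,
    integrals and finite sums of integrals are treated alike in this form. *)
Record positive_functional (Om : Type) (E : (Om -> R) -> Prop)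
    (I : (Om -> R) -> R) : Prop := PositiveFunctional {
  pf_dom0 : E (fun=> 0);
  pf_dom_lin : forall c f g, E f -> E g -> E (fun o => c * f o + g o);
  pf_dom_norm : forall f, E f -> E (fun o => `|f o|);
  pf_lin : forall c f g, E f -> E g ->
    I (fun o => c * f o + g o) = c * I f + I g;
  pf_mono : forall f g, E f -> E g -> (forall o, f o <= g o) -> I f <= I g }.

Variables (Om : Type) (E : (Om -> R) -> Prop) (I : (Om -> R) -> R).
Hypothesis IE : positive_functional E I.

Lemma pf0 : I (fun=> 0) = 0.
Proof.
have := pf_lin IE 1 (pf_dom0 IE) (pf_dom0 IE).
rewrite (_ : (fun o : Om => 1 * 0 + 0) = (fun=> 0)); last first.
  by apply/funext => o; rewrite mulr0 addr0.
by move=> h; lra.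
Qed.

Lemma pf_domD f g : E f -> E g -> E (fun o => f o + g o).
Proof.
move=> Ef Eg; have := pf_dom_lin IE 1 Ef Eg.
by congr E; apply/funext => o; rewrite mul1r.
Qed.

Lemma pf_domZ c f : E f -> E (fun o => c * f o).
Proof.
move=> Ef; have := pf_dom_lin IE c Ef (pf_dom0 IE).
by congr E; apply/funext => o; rewrite addr0.
Qed.

Lemma pf_domB f g : E f -> E g -> E (fun o => f o - g o).
Proof.
move=> Ef Eg; have := pf_dom_lin IE (-1) Eg Ef.
by congr E; apply/funext => o; rewrite mulN1r addrC.
Qed.

Lemma pf_dom_max f g : E f -> E g -> E (fun o => Num.max (f o) (g o)).
Proof.
move=> Ef Eg; have EN := pf_dom_norm IE (pf_domB Ef Eg).
have := pf_domZ 2^-1 (pf_domD (pf_domD Ef Eg) EN).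
by congr E; apply/funext => o; rewrite maxr_absE mulrC.
Qed.

Lemma pf_dom_min f g : E f -> E g -> E (fun o => Num.min (f o) (g o)).
Proof.
move=> Ef Eg; have EN := pf_dom_norm IE (pf_domB Ef Eg).
have := pf_domZ 2^-1 (pf_domB (pf_domD Ef Eg) EN).
by congr E; apply/funext => o; rewrite minr_absE mulrC.
Qed.

Lemma pf_dom_sum (J : finType) (f : J -> Om -> R) :
  (forall j, E (f j)) -> E (fun o => \sum_j f j o).
Proof.
move=> Ef; elim: (index_enum J) => [|j r IH].
  have := pf_dom0 IE; congr E; apply/funext => o; by rewrite big_nil.
have := pf_domD (Ef j) IH.
by congr E; apply/funext => o; rewrite big_cons.
Qed.

Lemma pf_dom_mean (J : finType) (f : J -> Om -> R) :
  (forall j, E (f j)) -> E (fun o => unif_mean (fun j => f j o)).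
Proof.
move=> Ef; have := pf_domZ (#|J|%:R^-1) (pf_dom_sum Ef).
by congr E; apply/funext => o; rewrite mulrC.
Qed.

Lemma pfD f g : E f -> E g -> I (fun o => f o + g o) = I f + I g.
Proof.
move=> Ef Eg; rewrite -[in RHS](mul1r (I f)) -(pf_lin IE)//.
by congr I; apply/funext => o; rewrite mul1r.
Qed.

Lemma pfZ c f : E f -> I (fun o => c * f o) = c * I f.
Proof.
move=> Ef; transitivity (c * I f + I (fun=> 0)); last by rewrite pf0 addr0.
rewrite -(pf_lin IE)//; last exact: (pf_dom0 IE).
by congr I; apply/funext => o; rewrite addr0.
Qed.

Lemma pf_sum (J : finType) (f : J -> Om -> R) :
  (forall j, E (f j)) -> I (fun o => \sum_j f j o) = \sum_j I (f j).
Proof.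
move=> Ef.
suff [] : E (fun o => \sum_j f j o) /\ 
    I (fun o => \sum_j f j o) = \sum_j I (f j) by [].
elim: (index_enum J) => [|j r [IHE IHI]].
  rewrite big_nil (_ : (fun o : Om => _) = (fun=> 0)).
    by split; [exact: (pf_dom0 IE)|exact: pf0].
  by apply/funext => o; rewrite big_nil.
rewrite big_cons -IHI -pfD// (_ : (fun o : Om => _) =
    (fun o => f j o + \sum_(j <- r) f j o)).
  by split => //; exact: pf_domD.
by apply/funext => o; rewrite big_cons.
Qed.

Lemma pf_mean (J : finType) (f : J -> Om -> R) : (forall j, E (f j)) ->
  I (fun o => unif_mean (fun j => f j o)) = unif_mean (fun j => I (f j)).
Proof.
move=> Ef; rewrite [in RHS]/unif_mean -pf_sum// mulrC.
rewrite -pfZ; last exact: pf_dom_sum.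
by congr I; apply/funext => o; rewrite mulrC.
Qed.

Lemma pf_ge0 f : E f -> (forall o, 0 <= f o) -> 0 <= I f.
Proof. by move=> Ef f0; rewrite -pf0; apply: (pf_mono IE) => //; exact: (pf_dom0 IE). Qed.

(** Expand the sum of the squares of the components of [d] orthogonal to [c]. *)
Lemma cauchy_schwarz_sum (J : finType) (c d : J -> R) :
  (\sum_j c j * d j) ^+ 2 <= (\sum_j c j ^+ 2) * (\sum_j d j ^+ 2).
Proof.
set C := \sum_j c j ^+ 2; set D := \sum_j d j ^+ 2; set P := \sum_j c j * d j.
have C0 : 0 <= C by apply: sumr_ge0 => j _; exact: sqr_ge0.
have [C00|Cn0] := eqVneq C 0.
  have c0 j : c j = 0.
    apply/eqP; rewrite -sqrf_eq0; apply/eqP.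
    by apply: (psumr_eq0P _ C00) => // i _; exact: sqr_ge0.
  rewrite C00 mul0r /P big1 ?expr0n// => j _; by rewrite c0 mul0r.
have : 0 <= \sum_j (C * d j - P * c j) ^+ 2.
  by apply: sumr_ge0 => j _; exact: sqr_ge0.
under eq_bigr => j _.
  rewrite (_ : _ ^+ 2 = C ^+ 2 * d j ^+ 2 + (- (2 * C * P)) * (c j * d j)
     + P ^+ 2 * c j ^+ 2); last by ring.
  over.
rewrite !big_split/= -!mulr_sumr -/C -/D -/P.
rewrite (_ : _ + _ = C * (C * D - P ^+ 2)); last by ring.
by rewrite pmulr_rge0 ?subr_ge0// lt_neqAle eq_sym Cn0.
Qed.

(** Minkowski's integral inequality in [l_2]: pairing [I d] with its own
    coordinates moves the Euclidean norm inside the functional. *)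
Lemma pf_minkowski (J : finType) (d : J -> Om -> R) (D : Om -> R) :
  (forall j, E (d j)) -> E D -> (forall o, 0 <= D o) ->
  (forall o, \sum_j d j o ^+ 2 <= D o ^+ 2) ->
  \sum_j I (d j) ^+ 2 <= I D ^+ 2.
Proof.
move=> Ed ED D0 dD; set S2 := \sum_j _.
have S20 : 0 <= S2 by apply: sumr_ge0 => j _; exact: sqr_ge0.
pose S := Num.sqrt S2.
have S2E : S2 = S ^+ 2 by rewrite sqr_sqrtr.
have ID0 : 0 <= I D by exact: pf_ge0.
have [S0|Sn0] := eqVneq S 0; first by rewrite S2E S0 expr0n/= sqr_ge0.
have Sp : 0 < S by rewrite lt_neqAle eq_sym Sn0 sqrtr_ge0.
rewrite S2E ler_pXn2r ?nnegrE ?(ltW Sp)//.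
rewrite -(ler_pM2l Sp) -expr2 -S2E.
have -> : S2 = I (fun o => \sum_j I (d j) * d j o).
  rewrite pf_sum; last by move=> j; exact: pf_domZ.
  by apply: eq_bigr => j _; rewrite pfZ// expr2.
rewrite -pfZ//; apply: (pf_mono IE).
- by apply: pf_dom_sum => j; exact: pf_domZ.
- exact: pf_domZ.
move=> o; rewrite (le_trans (ler_norm _))//.
rewrite -(ler_pXn2r (n:=2))// ?nnegrE// ?mulr_ge0//; last exact: ltW.
rewrite real_normK ?num_real// exprMn -S2E.
by rewrite (le_trans (cauchy_schwarz_sum _ _))// ler_wpM2l.
Qed.

End PositiveFunctionals.

Lemma weighted_sum_positive (R : realType) (K : finType) (w : K -> R) :
  (forall k, 0 <= w k) ->
  positive_functional (fun=> True) (fun f => \sum_k w k * f k).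
Proof.
move=> w0; split => // [c f g _ _|f g _ _ fg].
  by rewrite mulr_sumr -big_split/=; apply: eq_bigr => k _; ring.
by apply: ler_sum => k _; rewrite ler_wpM2l.
Qed.

(** * Cuts of the sign cube *)

Section SignCube.
Variables (R : realType) (n : nat).
Local Notation cube := {ffun 'I_n -> 'I_3}.

Definition freeze (e : cube) (j : 'I_n) (s : 'I_3) : cube :=
  [ffun i => if i == j then s else e i].

Lemma card_cube : (0 < #|{: cube}|)%N.
Proof. by apply/card_gt0P; exists [ffun=> ord0]. Qed.

(** Resampling one coordinate preserves the uniform law: exchanging the sample
    with the discarded coordinate is an involution of the product. *)
Lemma mean_freeze j (g : cube -> R) :
  unif_mean g = unif_mean (fun e => unif_mean (fun s => g (freeze e j s))).
Proof.
pose h (es : cube * 'I_3) := (freeze es.1 j es.2, es.1 j).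
have hK : involutive h.
  move=> [e s]; rewrite /h/= ffunE eqxx; congr (_, _).
  by apply/ffunP => i; rewrite !ffunE; case: eqP => [->|].
rewrite -(@mean_pair R cube 'I_3 (fun es => g (freeze es.1 j es.2))).
transitivity (unif_mean (fun es : cube * 'I_3 => g es.1)).
  rewrite mean_pair; apply: eq_mean => e.
  have I3 : (0 < #|'I_3|)%N by rewrite card_ord.
  exact: (esym (@mean_cst R 'I_3 (g e) I3)).
by rewrite -(mean_reindex _ (inv_bij hK)).
Qed.

Section Bessel.
Variable s : 'I_3.

Let score (j : 'I_n) (e : cube) : R := 3 * (e j == s)%:R - 1.

Let mean_score j (g : cube -> R) :
  unif_mean (fun e => score j e * g e) =
  unif_mean (fun e => g (freeze e j s)) - unif_mean g.
Proof.
rewrite (mean_freeze j g) (mean_freeze j) -[X in _ - X]mul1r -mulNr -meanZ -meanD.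
apply: eq_mean => e; rewrite /unif_mean card_ord !mulr_suml.
rewrite (bigD1 s)//= [X in _ = _ + _ * X](bigD1 s)//=.
rewrite /score ffunE eqxx eqxx.
under eq_bigr => t /negbTE ts.
  rewrite ffunE eqxx ts mulr0n mulr0 sub0r -mulrA.
  over.
rewrite -mulr_sumr/= mulr1n.
by field.
Qed.

(** The scores [3 * (e_j == s) - 1] are orthogonal with square norm 2, and
    pairing a function with one of them gives the deviation of the [j]-th
    conditional mean, so this is Bessel's inequality. *)
Lemma sum_sqr_conditional_mean_le (F : cube -> R) :
  \sum_j (unif_mean (fun e => F (freeze e j s)) - unif_mean F) ^+ 2 <=
  2 * (unif_mean (fun e => F e ^+ 2) - unif_mean F ^+ 2).
Proof.
set a := unif_mean F; pose c j := unif_mean (fun e => F (freeze e j s)) - a.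
pose L e := \sum_j c j * score j e.
have mL g : unif_mean (fun e => L e * g e) =
    \sum_j c j * (unif_mean (fun e => g (freeze e j s)) - unif_mean g).
  rewrite (_ : (fun e => _) = fun e => \sum_j c j * (score j e * g e)).
    by rewrite mean_sum; apply: eq_bigr => j _; rewrite meanZ mean_score.
  by apply/funext => e; rewrite mulr_suml; apply: eq_bigr => j _; rewrite mulrA.
have L1 : unif_mean L = 0.
  rewrite (_ : L = fun e => L e * 1); last by apply/funext => e; rewrite mulr1.
  by rewrite mL big1// => j _; rewrite !(mean_cst _ card_cube) subrr mulr0.
have LF : unif_mean (fun e => L e * F e) = \sum_j c j ^+ 2.
  by rewrite mL; apply: eq_bigr => j _; rewrite expr2.
have LL : unif_mean (fun e => L e * L e) = 2 * \sum_j c j ^+ 2.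
  rewrite mL mulr_sumr; apply: eq_bigr => j _; rewrite L1 subr0.
  rewrite mean_sum (bigD1 j)//= big1 => [|i ij].
    rewrite meanZ (_ : (fun e => _) = fun=> 2); first by rewrite (mean_cst _ card_cube); ring.
    by apply/funext => e; rewrite /score ffunE !eqxx mulr1n; lra.
  rewrite meanZ (_ : (fun e => _) = score i); last first.
    by apply/funext => e; rewrite /score ffunE (negbTE ij).
  rewrite (_ : score i = fun e => score i e * 1); last by apply/funext => e; rewrite mulr1.
  by rewrite mean_score !(mean_cst _ card_cube) subrr mulr0.
have : 0 <= unif_mean (fun e => (F e - a - 2^-1 * L e) ^+ 2).
  by apply: mean_ge0 => e; exact: sqr_ge0.
rewrite (_ : (fun e => _) = fun e => F e ^+ 2 + (-2 * a) * F e + a ^+ 2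
    + (-1) * (L e * F e) + a * L e + 4^-1 * (L e * L e)); last first.
  by apply/funext => e; field.
rewrite !meanD (mean_cst (a ^+ 2) card_cube) !meanZ L1 LF LL -/a -/c.
by rewrite -[\sum_(j < n) _]/(\sum_j c j ^+ 2); lra.
Qed.

End Bessel.

(** The probability that two at least of three independent events of
    probability [a] occur. *)
Definition maj_prob (a : R) : R := 3 * a ^+ 2 - 2 * a ^+ 3.

Lemma maj_probC a : maj_prob (1 - a) = 1 - maj_prob a.
Proof. by rewrite /maj_prob; ring. Qed.

(** The maximum [9/8] of [a * (3 - 2 * a)] is attained at [a = 3/4]. *)
Lemma maj_prob_le a : 0 <= a -> maj_prob a <= 9 / 8 * a.
Proof.
move=> a0; have : 0 <= a * (4 * a - 3) ^+ 2 by rewrite mulr_ge0// sqr_ge0.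
by rewrite /maj_prob; lra.
Qed.

Lemma maj_prob_ge0 a : 0 <= a <= 1 -> 0 <= maj_prob a.
Proof.
move=> /andP[a0 a1]; rewrite /maj_prob (_ : _ - _ = a ^+ 2 * (3 - 2 * a)).
  by rewrite mulr_ge0 ?exprn_ge0//; lra.
by ring.
Qed.

(** The difference quotient of [maj_prob] is at most [3/2] everywhere and at
    most [3 * (a + b) <= 12 * a]. *)
Lemma maj_prob_lip a b : 0 <= a <= 1 -> 0 <= b <= 1 -> b <= 3 * a ->
  (maj_prob a - maj_prob b) ^+ 2 <= 18 * a * (b - a) ^+ 2.
Proof.
move=> /andP[a0 a1] /andP[b0 b1] ba.
pose q := 3 * (a + b) - 2 * (a ^+ 2 + a * b + b ^+ 2).
have -> : maj_prob a - maj_prob b = (a - b) * q.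
  by rewrite /maj_prob /q; ring.
rewrite exprMn -(sqrrN (b - a)) opprB mulrC ler_wpM2r ?sqr_ge0//.
have q0 : 0 <= q.
  have aa : a ^+ 2 <= a by rewrite expr2 ler_piMl.
  have bb : b ^+ 2 <= b by rewrite expr2 ler_piMl.
  have ab1 : a * b <= a by rewrite ler_piMr.
  have ab2 : a * b <= b by rewrite ler_piMl.
  by rewrite /q; lra.
have q1 : q <= 3 / 2.
  have : 0 <= 3 / 2 * (a + b - 1) ^+ 2 + 2^-1 * (a - b) ^+ 2.
    by rewrite addr_ge0// mulr_ge0// sqr_ge0.
  by rewrite /q; lra.
have q2 : q <= 12 * a.
  have aa : 0 <= a ^+ 2 by exact: sqr_ge0.
  have bb : 0 <= b ^+ 2 by exact: sqr_ge0.
  have ab : 0 <= a * b by exact: mulr_ge0.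
  by rewrite /q; lra.
rewrite expr2 (le_trans (ler_wpM2l q0 q1))//; lra.
Qed.

Definition cube_prob (A : cube -> bool) : R :=
  unif_mean (fun e => (A e)%:R).

(** One cut: with [u] the probability that a random corner falls on the other
    side of the cut than [o], the square of the Lipschitz bound contributes
    [18 u] and Bessel's inequality contributes [2 u]. *)
Lemma sum_sqr_maj_prob_le (A : cube -> bool) (o : cube) (s : 'I_3) :
  \sum_j (maj_prob (cube_prob A) -
          maj_prob (cube_prob (fun e => A (freeze e j s)))) ^+ 2
  <= (6 * unif_mean (fun e => `|(A e)%:R - (A o)%:R|)) ^+ 2.
Proof.
(* complementing A exchanges a with 1 - a and fixes both sides *)
wlog Ao : A / A o = false => [H|].
  case Ao : (A o); last by have := H _ Ao; rewrite Ao.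
  have := H (fun e => ~~ A e); rewrite Ao => /(_ erefl) /=.
  have mC (g : cube -> cube) :
      cube_prob (fun e => ~~ A (g e)) = 1 - cube_prob (fun e => A (g e)).
    rewrite -(mean_cst 1 card_cube) -[X in _ - X]mul1r -mulNr -meanZ -meanD.
    by apply: eq_mean => e; case: (A _); rewrite ?mulr1n ?mulr0n; lra.
  rewrite (mC id) maj_probC.
  under eq_bigr => j _ do rewrite (mC (fun e => freeze e j s)) maj_probC.
  rewrite (_ : (fun e => `|(~~ A e)%:R - false%:R|) =
    (fun e => `|(A e)%:R - true%:R|)); last first.
    apply/funext => e; case: (A e); rewrite /= ?subrr ?normr0 ?subr0 ?normr1//.
    by rewrite sub0r normrN normr1.
  apply: le_trans; apply: ler_sum => j _.
  by rewrite -sqrrN le_eqVlt; apply/orP; left; apply/eqP; congr (_ ^+ 2); ring.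
set a := cube_prob A.
have mb (g : cube -> cube) : 0 <= cube_prob (fun e => A (g e)) <= 1.
  rewrite mean_ge0//= -[leRHS](mean_cst 1 card_cube).
  by apply: le_mean => e; case: (A _); rewrite //= ler01.
have -> : unif_mean (fun e => `|(A e)%:R - (A o)%:R|) = a.
  by apply: eq_mean => e; rewrite Ao subr0 ger0_norm.
have /andP[a0 a1] := mb id.
apply: (@le_trans _ _ (\sum_j 18 * a *
   (cube_prob (fun e => A (freeze e j s)) - a) ^+ 2)).
  apply: ler_sum => j _; apply: maj_prob_lip => //; first exact: (mb id).
  rewrite /a /cube_prob [X in _ <= _ * X](mean_freeze j) -meanZ.
  apply: le_mean => e.
  rewrite /unif_mean card_ord mulrC divfK// (bigD1 s)//= lerDl.
  by apply: sumr_ge0.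
rewrite -mulr_sumr.
have := sum_sqr_conditional_mean_le s (fun e => (A e)%:R).
rewrite -/(cube_prob A) -/a.
rewrite (_ : (fun e => _ ^+ 2) = (fun e => (A e)%:R)); last first.
  by apply/funext => e; case: (A e); rewrite ?expr1n ?expr0n.
rewrite -/(cube_prob A) -/a => H.
apply: (le_trans (ler_wpM2l _ H)); first by rewrite mulr_ge0.
have : 0 <= a ^+ 2 * a by rewrite mulr_ge0// sqr_ge0.
by lra.
Qed.

End SignCube.

(** * Layer cake and medians of three samples *)

Section LayerCake.
Variable R : realType.

(** For [v] an entry of [s], the [i]-th term is the increment of [min v] from
    one entry to the next, so the sum telescopes. *)
Lemma sorted_layer_cake (s : seq R) (v : R) : sorted <=%R s -> v \in s ->
  v = s`_0 + \sum_(i < (size s).-1) (s`_i.+1 - s`_i) * (s`_i.+1 <= v)%R%:R.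
Proof.
move=> ss vs; have s0 : (0 < size s)%N by case: s vs {ss}.
have smono i j : (i <= j < size s)%N -> s`_i <= s`_j.
  move=> /andP[ij js]; have is' := leq_ltn_trans ij js.
  by apply: (sorted_leq_nth (@le_trans _ R) (@lexx _ R)).
pose k := index v s; have ks : (k < size s)%N by rewrite index_mem.
have vk : s`_k = v by exact: nth_index.
rewrite (eq_bigr (fun i : 'I__ => Num.min v s`_i.+1 - Num.min v s`_i)); last first.
  move=> i _; have is' : (i.+1 < size s)%N by rewrite -ltn_predRL.
  have ii1 : s`_i <= s`_i.+1 by apply: smono; rewrite leqnSn.
  have [ki|ik] := leqP i.+1 k.
    have v1 : s`_i.+1 <= v by rewrite -vk; apply: smono; rewrite ki.
    by rewrite v1 mulr1 !min_r// (le_trans ii1).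
  have v1 : v <= s`_i by rewrite -vk; apply: smono; rewrite -ltnS ik ltnW.
  rewrite !min_l ?(le_trans v1)// subrr.
  case: (leP s`_i.+1 v) => [h|_]; last by rewrite mulr0.
  by rewrite (_ : s`_i.+1 - s`_i = 0) ?mul0r//; lra.
rewrite -(big_mkord xpredT (fun i => Num.min v s`_i.+1 - Num.min v s`_i)).
rewrite (telescope_sumr (fun i => Num.min v s`_i))// min_l; last first.
  by rewrite -[leLHS]vk; apply: smono; rewrite ltn_predL s0 andbT -ltnS prednK.
rewrite min_r; first by rewrite addrC subrK.
by rewrite -[leRHS]vk; apply: smono.
Qed.

(** The thresholds are the values of [F] above the smallest, in increasing order,
    and the weights are the gaps before them; only differences of [F] matter below, which makes the constant
    disappear. *)
Lemma layer_cake (X : finType) (F : X -> R) : exists (K : nat) (w t : 'I_K -> R),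
  (forall k, 0 <= w k) /\
  forall x y, F x - F y = \sum_k w k * ((t k <= F x)%R%:R - (t k <= F y)%R%:R).
Proof.
pose s := sort <=%R (codom F).
have ss : sorted <=%R s by apply: sort_sorted; exact: le_total.
have Fs x : F x \in s by rewrite mem_sort codom_f.
exists (size s).-1; exists (fun i => s`_i.+1 - s`_i); exists (fun i => s`_i.+1).
split.
  move=> i; rewrite subr_ge0.
  by apply: (sorted_leq_nth (@le_trans _ R) (@lexx _ R)) => //;
    rewrite ?inE -?ltn_predRL// ltnW// -ltn_predRL.
move=> x y; rewrite {1}(sorted_layer_cake ss (Fs x)) {1}(sorted_layer_cake ss (Fs y)).
rewrite opprD addrACA subrr add0r -sumrB.
by apply: eq_bigr => i _; rewrite mulrBr.
Qed.

Definition med (x y z : R) : R := Num.max (Num.min x y) (Num.min (Num.max x y) z).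

Lemma med_mem x y z : med x y z \in [:: x; y; z].
Proof.
rewrite /med !inE; case: (leP x y) => _; case: (leP _ z) => _;
  by case: (leP _ _) => _; rewrite eqxx ?orbT.
Qed.

(** A superlevel set of the median is the majority of the superlevel sets; its
    indicator is a polynomial in theirs, whose mean under independence is then
    immediate. *)
Lemma le_med t x y z : ((t <= med x y z)%R%:R : R) =
  (t <= x)%R%:R * (t <= y)%R%:R + (t <= x)%R%:R * (t <= z)%R%:R
    + (t <= y)%R%:R * (t <= z)%R%:R - 2 * ((t <= x)%R%:R * (t <= y)%R%:R * (t <= z)%R%:R).
Proof.
rewrite /med le_max !le_min le_max.
by case: (t <= x); case: (t <= y); case: (t <= z); rewrite /= ?mulr1n ?mulr0n; lra.
Qed.

End LayerCake.

Section MedianSmoothing.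
Variables (R : realType) (n : nat).
Local Notation cube := {ffun 'I_n -> 'I_3}.

(** The mean of the median of three independent samples: a nonlinear smoothing
    which turns a cut of measure [a] into one of measure [maj_prob a]. *)
Definition mean_med (F : cube -> R) : R :=
  unif_mean (fun t : cube * cube * cube => med (F t.1.1) (F t.1.2) (F t.2)).

Lemma mean_maj (f : cube -> R) (a := unif_mean f) :
  unif_mean (fun t : cube * cube * cube => f t.1.1 * f t.1.2 + f t.1.1 * f t.2
    + f t.1.2 * f t.2 - 2 * (f t.1.1 * f t.1.2 * f t.2)) = maj_prob a.
Proof.
rewrite mean_pair mean_pair /=.
have maff (b c : R) : unif_mean (fun e => b + c * f e) = b + c * a.
  by rewrite meanD meanZ (mean_cst b (card_cube n)).
under eq_mean => e1.
  under eq_mean => e2.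
    under eq_mean => e3.
      rewrite (_ : _ - _ = f e1 * f e2 + (f e1 + f e2 - 2 * f e1 * f e2) * f e3); last by ring.
      over.
    rewrite maff (_ : _ + _ = f e1 * a + (f e1 + a - 2 * a * f e1) * f e2); last by ring.
    over.
  rewrite maff (_ : _ + _ = a ^+ 2 + (2 * a - 2 * a ^+ 2) * f e1); last by ring.
  over.
by rewrite maff /maj_prob; ring.
Qed.

(** The median of three values of [F] is again a value of [F], so the layer
    decomposition of [F] applies to it.  The map [g] is the identity or the
    freezing of a coordinate; both are expanded in the same layers. *)
Lemma mean_med_layers (F : cube -> R) (K : nat) (w t : 'I_K -> R) :
  (forall x y, F x - F y = \sum_k w k * ((t k <= F x)%R%:R - (t k <= F y)%R%:R)) ->
  forall (g : cube -> cube) (o : cube), mean_med (F \o g) - F o =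
  \sum_k w k * (maj_prob (cube_prob R (fun e => t k <= F (g e))) - (t k <= F o)%R%:R).
Proof.
move=> Fw g o.
have ct3 : (0 < #|{: cube * cube * cube}|)%N.
  by rewrite !card_prod !muln_gt0 !card_cube.
rewrite /mean_med -[X in _ - X](mean_cst _ ct3) -[X in _ - X]mul1r -mulNr -meanZ -meanD.
rewrite (_ : (fun e => _) = fun e : cube * cube * cube => \sum_k w k *
  ((t k <= med (F (g e.1.1)) (F (g e.1.2)) (F (g e.2)))%R%:R + (-1) * (t k <= F o)%R%:R)).
  rewrite mean_sum; apply: eq_bigr => k _; rewrite meanZ meanD.
  rewrite (mean_cst (-1 * _) ct3) mulN1r; congr (_ * (_ - _)).
  rewrite -mean_maj; apply: eq_mean => e.
  by rewrite le_med.
apply/funext => e; rewrite mulN1r /=.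
have [z ->] : exists z, med (F (g e.1.1)) (F (g e.1.2)) (F (g e.2)) = F z.
  have := med_mem (F (g e.1.1)) (F (g e.1.2)) (F (g e.2)).
  by rewrite !inE => /or3P[]/eqP->; eexists.
by rewrite Fw; apply: eq_bigr => k _; rewrite mulN1r.
Qed.

(** The layers are nested, so all terms of the decomposition of a difference
    have the same sign. *)
Lemma norm_layers (F : cube -> R) (K : nat) (w t : 'I_K -> R) :
  (forall k, 0 <= w k) ->
  (forall x y, F x - F y = \sum_k w k * ((t k <= F x)%R%:R - (t k <= F y)%R%:R)) ->
  forall x y, `|F x - F y| =
    \sum_k w k * `|(t k <= F x)%R%:R - (t k <= F y)%R%:R|.
Proof.
move=> w0 Fw x y; wlog xy : x y / F y <= F x => [H|].
  have [/H//|/ltW/H] := leP (F y) (F x).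
  by rewrite distrC => ->; apply: eq_bigr => k _; rewrite distrC.
rewrite ger0_norm ?subr_ge0// Fw; apply: eq_bigr => k _; congr (_ * _).
rewrite ger0_norm// subr_ge0 ler_nat.
by case: (leP (t k) (F y)) => // h; rewrite (le_trans h xy).
Qed.

(** Layer by layer this is [maj_prob a <= 9 / 8 * a], with [1 - a] in place of
    [a] for the layers which contain [o]. *)
Lemma mean_med_dist (F : cube -> R) (o : cube) :
  `|F o - mean_med F| <= 9 / 8 * unif_mean (fun e => `|F e - F o|).
Proof.
have [K [w [t [w0 Fw]]]] := layer_cake F.
rewrite distrC (mean_med_layers Fw id o).
under eq_mean do rewrite (norm_layers w0 Fw).
rewrite mean_sum mulr_sumr (le_trans (ler_norm_sum _ _ _))//.
apply: ler_sum => k _; rewrite meanZ normrM ger0_norm// mulrCA ler_wpM2l//.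
set A := fun e => t k <= F e; rewrite -/(A o).
have a01 : 0 <= cube_prob R A <= 1.
  rewrite mean_ge0//= -[leRHS](mean_cst 1 (card_cube n)).
  by apply: le_mean => e; case: (A _); rewrite //= ler01.
have /andP[a0 a1] := a01.
case Ao : (A o).
  rewrite (_ : unif_mean _ = 1 - cube_prob R A).
    rewrite distrC -maj_probC ger0_norm ?maj_prob_le ?maj_prob_ge0//; lra.
  rewrite -[X in X - _](mean_cst 1 (card_cube n)) -[X in _ - X]mul1r -mulNr -meanZ -meanD.
  apply: eq_mean => e; rewrite -/(A e).
  by case: (A e); rewrite ?subrr ?normr0 ?sub0r ?normrN ?normr1 ?mulr1n ?mulr0n; lra.
rewrite subr0 ger0_norm ?maj_prob_ge0// (_ : unif_mean _ = cube_prob R A) ?maj_prob_le//.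
by apply: eq_mean => e; rewrite -/(A e) subr0 ger0_norm.
Qed.

(** Each layer satisfies the bound by [sum_sqr_maj_prob_le], and Minkowski's
    inequality for the sum over the layers adds up the right-hand sides. *)
Lemma sum_sqr_mean_med_le (F : cube -> R) (o : cube) (s : 'I_3) :
  \sum_j (mean_med F - mean_med (fun e => F (freeze e j s))) ^+ 2 <=
  (6 * unif_mean (fun e => `|F e - F o|)) ^+ 2.
Proof.
have [K [w [t [w0 Fw]]]] := layer_cake F.
pose A k e := t k <= F e.
pose d (j : 'I_n) k := maj_prob (cube_prob R (A k)) -
  maj_prob (cube_prob R (fun e => A k (freeze e j s))).
pose D k := 6 * unif_mean (fun e => `|(A k e)%:R - (A k o)%:R| : R).
rewrite (_ : 6 * _ = \sum_k w k * D k); last first.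
  under eq_mean do rewrite (norm_layers w0 Fw).
  rewrite mean_sum mulr_sumr; apply: eq_bigr => k _.
  by rewrite meanZ mulrCA.
rewrite (eq_bigr (fun j => (\sum_k w k * d j k) ^+ 2)); last first.
  move=> j _; congr (_ ^+ 2).
  rewrite (_ : _ - _ = (mean_med F - F o) - (mean_med (F \o (fun e => freeze e j s)) - F o)).
    rewrite (mean_med_layers Fw id o) (mean_med_layers Fw (fun e => freeze e j s) o).
    by rewrite -sumrB; apply: eq_bigr => k _; rewrite -mulrBr /d /A; ring.
  by rewrite /= /comp; ring.
apply: (pf_minkowski (weighted_sum_positive w0)) => //.
  by move=> k; rewrite mulr_ge0// mean_ge0.
by move=> k; exact: sum_sqr_maj_prob_le.
Qed.

End MedianSmoothing.

(** * The cotype inequality for a positive functional *)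

(** Minkowski's inequality, in the form that the convexity of the [p]-th power
    gives when the weights [c i] are known beforehand. *)
Lemma sum_mean_powR_le (R : realType) (J X : finType) (n : nat) (p Q K0 : R)
    (u : 'I_n -> X -> R) (c : J -> R) (v : J -> 'I_n -> X -> R) :
  1 <= p -> 0 < K0 -> \sum_i c i = K0 -> (forall i, 0 <= c i) ->
  (forall j x, 0 <= u j x) -> (forall i j x, 0 <= v i j x) ->
  (forall j x, u j x <= \sum_i c i * v i j x) ->
  (forall i, \sum_j unif_mean (fun x => v i j x `^ p) <= Q) ->
  \sum_j unif_mean (fun x => u j x `^ p) <= K0 `^ p * Q.
Proof.
move=> p1 K0p cK c0 u0 v0 uv vQ.
have cK1 : \sum_i c i / K0 = 1 by rewrite -mulr_suml cK divff// gt_eqF.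
have cK0 i : 0 <= c i / K0 by rewrite divr_ge0// ltW.
apply: (@le_trans _ _ (\sum_j unif_mean
    (fun x => K0 `^ p * \sum_i c i / K0 * v i j x `^ p))).
  apply: ler_sum => j _; apply: le_mean => x.
  have vJ := powR_jensen p1 cK0 cK1 (v0^~ j^~ x).
  rewrite (le_trans _ (ler_wpM2l (powR_ge0 _ _) vJ))//.
  rewrite -powRM ?(ltW K0p) ?sumr_ge0//; last by move=> i _; rewrite mulr_ge0.
  rewrite ge0_ler_powR ?nnegrE//; first by lra.
    by rewrite mulr_ge0 ?(ltW K0p)// sumr_ge0// => i _; rewrite mulr_ge0.
  rewrite (le_trans (uv j x))// mulr_sumr ler_sum// => i _.
  by rewrite mulrA mulrCA divff ?gt_eqF// mulr1.
under eq_bigr do rewrite meanZ mean_sum.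
rewrite -mulr_sumr ler_wpM2l ?powR_ge0// exchange_big/=.
rewrite -[leRHS]mul1r -cK1 mulr_suml; apply: ler_sum => i _.
by under eq_bigr do rewrite meanZ; rewrite -mulr_sumr ler_wpM2l.
Qed.

Section AbstractCotype.
Variables (R : realType) (Om : Type) (E : (Om -> R) -> Prop) (I : (Om -> R) -> R).
Hypothesis IE : positive_functional E I.
Variables (m n : nat) (f : torus m n -> Om -> R).
Hypothesis Ef : forall x, E (f x).

Let N (g : Om -> R) : R := I (fun o => `|g o|).

Let cube := {ffun 'I_n -> 'I_3}.

Definition smoothing (x : torus m n) (o : Om) : R :=
  mean_med (fun e : cube => f (x + sign_shift m e) o).

Definition frozen_smoothing (j : 'I_n) (s : 'I_3) (x : torus m n) (o : Om) : R :=
  mean_med (fun e : cube => f (x + sign_shift m (freeze e j s)) o).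

Definition local_oscillation (x : torus m n) : R :=
  unif_mean (fun e : cube => N (f (x + sign_shift m e) - f x)).

Let osc x o : R := unif_mean (fun e : cube => `|f (x + sign_shift m e) o - f x o|).

Let E_mean_med (F : cube -> Om -> R) : (forall e, E (F e)) ->
  E (fun o => mean_med (F^~ o)).
Proof.
move=> EF; apply: (pf_dom_mean IE) => t; rewrite /med.
apply: (pf_dom_max IE); first exact: (pf_dom_min IE).
by apply: (pf_dom_min IE) => //; exact: (pf_dom_max IE).
Qed.

Let E_smoothing x : E (smoothing x).
Proof. exact: (E_mean_med (fun e => Ef (x + sign_shift m e))). Qed.

Let E_frozen j s x : E (frozen_smoothing j s x).
Proof. exact: (E_mean_med (fun e => Ef (x + sign_shift m (freeze e j s)))). Qed.

Let E_dist g h : E g -> E h -> E (fun o => `|g o - h o|).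
Proof. by move=> Eg Eh; apply: (pf_dom_norm IE); exact: (pf_domB IE). Qed.

Let E_osc x : E (osc x).
Proof. by apply: (pf_dom_mean IE) => e; exact: E_dist. Qed.

Let I_osc x : I (osc x) = local_oscillation x.
Proof. by rewrite (pf_mean IE)// => e; exact: E_dist. Qed.

Let N_ge0 g h : E g -> E h -> 0 <= N (g - h).
Proof. by move=> Eg Eh; apply: (pf_ge0 IE) => //; exact: E_dist. Qed.

Let N_tri g h k : E g -> E h -> E k -> N (g - k) <= N (g - h) + N (h - k).
Proof.
move=> Eg Eh Ek; rewrite /N -(pfD IE); [|exact: E_dist..].
apply: (pf_mono IE); [exact: E_dist| |].
  by apply: (pf_domD IE); exact: E_dist.
by move=> o; exact: ler_distD.
Qed.

Let N_sym g h : N (g - h) = N (h - g).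
Proof. by congr I; apply/funext => o; exact: distrC. Qed.

Lemma local_oscillation_ge0 x : 0 <= local_oscillation x.
Proof. by apply: mean_ge0 => e; exact: N_ge0. Qed.

(* the coordinate 1 of 'I_3 encodes the sign 0 *)
Let center : cube := [ffun=> @Ordinal 3 1 isT].

Let sign_shift_center : sign_shift m center = 0.
Proof. by apply/rowP => j; rewrite !mxE ffunE subrr. Qed.

Lemma smoothing_dist x : N (f x - smoothing x) <= 9 / 8 * local_oscillation x.
Proof.
rewrite -I_osc -(pfZ IE)//; apply: (pf_mono IE).
- exact: E_dist.
- exact: (pf_domZ IE).
move=> o; have := @mean_med_dist R n (fun e => f (x + sign_shift m e) o) center.
by rewrite sign_shift_center addr0.
Qed.

Lemma sum_sqr_frozen_le x s :
  \sum_j N (smoothing x - frozen_smoothing j s x) ^+ 2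
  <= (6 * local_oscillation x) ^+ 2.
Proof.
rewrite -I_osc -(pfZ IE)//; apply: (pf_minkowski IE).
- by move=> j; exact: E_dist.
- exact: (pf_domZ IE).
- by move=> o; rewrite mulr_ge0// mean_ge0.
move=> o; have := @sum_sqr_mean_med_le R n (fun e => f (x + sign_shift m e) o) center s.
rewrite sign_shift_center addr0; apply: le_trans.
by apply: ler_sum => j _; rewrite real_normK ?num_real.
Qed.

Let unit_shift (j : 'I_n) : torus m n := delta_mx 0 j.

(** The values 2 and 1 of the frozen coordinate encode the signs 1 and 0. *)
Lemma frozen_smoothing_shift j x :
  frozen_smoothing j (@Ordinal 3 2 isT) x =
  frozen_smoothing j (@Ordinal 3 1 isT) (x + unit_shift j).
Proof.
apply/funext => o; congr mean_med; apply/funext => e.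
congr (f _ o); rewrite -addrA; congr (x + _).
apply/rowP => i; rewrite !mxE !ffunE eqxx/= eq_sym.
case: (eqVneq j i) => _ /=; last by rewrite add0r.
by rewrite subrr addr0 mulr2n addrK.
Qed.

Let half_step (b : bool) (j : 'I_n) (x : torus m n) : R :=
  N (smoothing x -
     frozen_smoothing j (if b then @Ordinal 3 2 isT else @Ordinal 3 1 isT) x).

Let half_step_ge0 b j x : 0 <= half_step b j x.
Proof. exact: N_ge0. Qed.

Let steps (j : 'I_n) (i : nat) : torus m n := i%:R *: delta_mx 0 j.

Let stepsS j i : steps j i.+1 = steps j i + unit_shift j.
Proof. by rewrite /steps -natr1 scalerDl scale1r. Qed.

(** One unit step of [smoothing] passes through a frozen smoothing common to
    its two ends, hence costs one half step at each of them. *)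
Lemma smoothing_steps j k x :
  N (smoothing (x + steps j k) - smoothing x) <=
  \sum_(i < k) (half_step true j (x + steps j i)
                + half_step false j (x + steps j i.+1)).
Proof.
elim: k => [|k IH].
  rewrite big_ord0 /steps scale0r addr0 subrr /N.
  rewrite (_ : (fun o => _) = fun=> 0) ?(pf0 IE)//.
  by apply/funext => o; rewrite normr0.
rewrite big_ord_recr/=.
apply: (le_trans (@N_tri _ (smoothing (x + steps j k)) _ _ _ _)) => //.
rewrite [leRHS]addrC lerD//.
apply: (le_trans (@N_tri _ (frozen_smoothing j (@Ordinal 3 2 isT) (x + steps j k)) _ _ _ _)) => //.
rewrite addrC lerD//; first by rewrite N_sym.
by rewrite frozen_smoothing_shift -addrA -stepsS.
Qed.

Lemma antipodal_dist_le j x :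
  N (f (x + half_shift m j) - f x) <=
  9 / 8 * local_oscillation (x + half_shift m j) + 9 / 8 * local_oscillation x +
  \sum_(i < m./2) (half_step true j (x + steps j i)
                + half_step false j (x + steps j i.+1)).
Proof.
apply: (le_trans (@N_tri _ (smoothing (x + half_shift m j)) _ _ _ _)) => //.
rewrite -[leRHS]addrA lerD//; first exact: smoothing_dist.
apply: (le_trans (@N_tri _ (smoothing x) _ _ _ _)) => //.
rewrite [leLHS]addrC lerD//; first by rewrite N_sym; exact: smoothing_dist.
exact: smoothing_steps.
Qed.

Let sum_half_step_le (p : R) b : 1 <= p -> (0 < n)%N ->
  unif_mean (fun x => \sum_j half_step b j x `^ p) <=
  unif_mean (fun x => n%:R `^ Num.max (1 - p / 2) 0 * (6 * local_oscillation x) `^ p).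
Proof.
move=> p1 n0; apply: le_mean => x; apply: sum_powR_le => //.
  by rewrite mulr_ge0// local_oscillation_ge0.
exact: sum_sqr_frozen_le.
Qed.

(** The decomposition of the antipodal distance is weighted by the [l_p] sizes
    of its terms: [b = n^(1/p)] for the two copies of the oscillation, which do
    not depend on the direction beyond a translation, and [6 a] for each of the
    [m] half steps, whose squares sum to at most [(6 D)^2]. *)
Theorem abstract_cotype (p : R) : 1 <= p -> ~~ odd m -> (0 < n)%N ->
  antipodal_sum N p f <=
  (6 * m%:R * n%:R `^ Num.max (p^-1 - 2^-1) 0 + 9 / 4 * n%:R `^ p^-1) `^ p
  * sign_mean N p f.
Proof.
move=> p1 m2 n0; have p0 : 0 < p by lra.
have nR : 0 < n%:R :> R by rewrite ltr0n.
set a := n%:R `^ Num.max _ _; set b := n%:R `^ _; set K0 := _ + _.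
have ap : 0 < a by rewrite powR_gt0.
have bp : 0 < b by rewrite powR_gt0.
have aE : a `^ p = n%:R `^ Num.max (1 - p / 2) 0.
  rewrite -powRrM maxr_pMl ?(ltW p0)// mul0r mulrBl mulVf ?gt_eqF//.
  by rewrite [2^-1 * p]mulrC.
have bE : b `^ p = n%:R by rewrite -powRrM mulVf ?gt_eqF// powRr1// ltW.
have DQ : unif_mean (fun x => local_oscillation x `^ p) <= sign_mean N p f.
  rewrite /sign_mean mean_pair; apply: le_mean => x.
  apply: powR_mean => //; first exact: card_cube.
  by move=> e; exact: N_ge0.
apply: le_trans (ler_wpM2l (powR_ge0 _ _) DQ).
(* inl: the two ends of the path; inr: the two half steps of each unit step *)
pose J := (bool + 'I_(m./2) * bool)%type.
pose c (i : J) := if i is inl _ then 9 / 8 * b else 6 * a.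
pose v (i : J) (j : 'I_n) x := match i with
  | inl s => local_oscillation (if s then x + half_shift m j else x) / b
  | inr (i, s) => half_step s j (x + steps j (if s then i : nat else i.+1)) / (6 * a)
  end.
apply: (@sum_mean_powR_le _ J _ _ _ _ _ _ c v) => //.
- by rewrite ltr_wpDl ?mulr_ge0 ?mulr_gt0// ltW.
- rewrite big_sumType/= !sumr_const card_bool card_prod card_ord card_bool.
  rewrite -[_ *+ 2]mulr_natr -[_ *+ (_ * _)%N]mulr_natr natrM.
  rewrite /K0; have -> : m%:R = (m./2)%:R * 2%:R :> R.
    by rewrite -natrM muln2 even_halfK.
  by field.
- by move=> [s|s]; rewrite /c !mulr_ge0// ltW.
- by move=> j x; exact: N_ge0.
- move=> [s|[i s]] j x; rewrite /v divr_ge0 ?local_oscillation_ge0 ?half_step_ge0//.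
    exact: ltW.
  by rewrite mulr_ge0// ltW.
- move=> j x; rewrite (le_trans (antipodal_dist_le j x))// le_eqVlt; apply/orP; left; apply/eqP.
  have bn : b != 0 by rewrite gt_eqF.
  have an : a != 0 by rewrite gt_eqF.
  rewrite big_sumType/= big_bool/=; congr (_ + _); first by field.
  transitivity (\sum_i \sum_s c (inr (i, s)) * v (inr (i, s)) j x).
    by apply: eq_bigr => i _; rewrite big_bool/=; field.
  by rewrite pair_bigA; apply: eq_bigr => -[].
have divp x c0 : 0 < c0 -> 0 <= x -> (x / c0) `^ p = (c0 `^ p)^-1 * x `^ p.
  move=> c00 x0; rewrite powRM// ?invr_ge0 ?(ltW c00)// mulrC; congr (_ * _).
  by rewrite -[c0^-1]powR_inv1 ?(ltW c00)// -powRrM mulN1r powRN.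
case=> [s|[i s]].
  rewrite /v (eq_bigr (fun _ => (b `^ p)^-1 * unif_mean (fun x => local_oscillation x `^ p))).
    by rewrite sumr_const card_ord -[_ *+ _]mulr_natl mulrA bE divff ?mul1r// gt_eqF.
  move=> j _; rewrite -meanZ.
  rewrite -[RHS](mean_translate _ (if s then half_shift m j else 0)); apply: eq_mean => x.
  by rewrite divp ?local_oscillation_ge0//; case: s; rewrite ?addr0.
rewrite /v (eq_bigr (fun j => ((6 * a) `^ p)^-1 * unif_mean (fun x => half_step s j x `^ p))).
  rewrite -mulr_sumr -mean_sum ler_pdivrMl ?powR_gt0 ?mulr_gt0//.
  rewrite (le_trans (sum_half_step_le s p1 n0))// -aE -meanZ; apply: le_mean => x.
  have D0 := local_oscillation_ge0 x.
  have D60 : 0 <= 6 * local_oscillation x by exact: mulr_ge0.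
  have a60 : 0 <= 6 * a by rewrite mulr_ge0// ltW.
  rewrite -!powRM ?D60 ?D0 ?a60 ?(ltW ap)//.
  by rewrite le_eqVlt; apply/orP; left; apply/eqP; congr (_ `^ _); ring.
move=> j _; rewrite -meanZ.
rewrite -[RHS](mean_translate _ (steps j (if s then i : nat else i.+1))).
by apply: eq_mean => x; rewrite divp ?mulr_gt0.
Qed.

End AbstractCotype.

(** * Plane geometry: the modulus as a limit of sums of projections *)

Section Trigonometry.
Variable R : realType.

Lemma lipschitz1_MVT (f df : R -> R) : (forall x : R, is_derive x 1 f (df x)) ->
  (forall x, `|df x| <= 1) -> forall x y, `|f x - f y| <= `|x - y|.
Proof.
move=> fdf df1 x y; wlog xy : x y / y < x => [H|].
  have [/H|/H//|->] := ltgtP x y; last by rewrite !subrr.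
  by rewrite distrC [leRHS]distrC.
have [|z _ ->] := @MVT R f df y x xy (fun z _ => fdf z).
  apply: continuous_subspaceT => z; apply: differentiable_continuous.
  by apply/derivable1_diffP; case: (fdf z).
by rewrite normrM ler_piMl.
Qed.

Lemma cos_lipschitz (x y : R) : `|cos x - cos y| <= `|x - y|.
Proof.
by apply: (lipschitz1_MVT (fun x => is_derive_cos x)) => z; rewrite normrN sin_max.
Qed.

Lemma norm_sin_le (x : R) : `|sin x| <= `|x|.
Proof.
have := lipschitz1_MVT (fun x => is_derive_sin x) (@cos_max R) x 0.
by rewrite sin0 !subr0.
Qed.

Section Directions.
Variable K : nat.
Hypothesis K0 : (0 < K)%N.

(** The total length of the projections of the unit vector of angle [al] on [K]
    equally spaced lines. *)
Definition proj_sum (al : R) : R :=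
  \sum_(k < K) `|cos (k%:R * (pi / K%:R) - al)|.

Let KR : 0 < K%:R :> R. Proof. by rewrite ltr0n. Qed.

Let proj_sum_shift al : proj_sum (al + pi / K%:R) = proj_sum al.
Proof.
rewrite /proj_sum; move: KR; case: K K0 => // k _ kR.
rewrite big_ord_recl [RHS]big_ord_recr addrC /=; congr (_ + _).
  apply: eq_bigr => i _; congr (`| cos _ |).
  by rewrite /bump/= add1n -natr1; field; rewrite gt_eqF.
rewrite -(normrN (cos _)) -cosDpi; congr (`| cos _ |).
by rewrite -natr1; field; rewrite natr1 gt_eqF.
Qed.

Let proj_sum_shiftn al j : proj_sum (al + j%:R * (pi / K%:R)) = proj_sum al.
Proof.
elim: j => [|j IH]; first by rewrite mul0r addr0.
by rewrite -natr1 mulrDl mul1r addrA proj_sum_shift.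
Qed.

Let proj_sum_lip al be : `|proj_sum al - proj_sum be| <= K%:R * `|al - be|.
Proof.
rewrite /proj_sum -sumrB (le_trans (ler_norm_sum _ _ _))//.
apply: (@le_trans _ _ (\sum_(k < K) `|al - be|)); last first.
  by rewrite sumr_const card_ord mulr_natl.
apply: ler_sum => k _; rewrite (le_trans (ler_dist_dist _ _))//.
by rewrite (le_trans (cos_lipschitz _ _))// opprD opprK addrACA subrr add0r addrC distrC.
Qed.

(** The sum is [K]-Lipschitz and has period [pi / K], so it oscillates by at
    most [pi], however large [K] is. *)
Lemma proj_sum_osc al be : `|proj_sum al - proj_sum be| <= pi.
Proof.
wlog ab : al be / be <= al => [H|].
  by have [/H//|/ltW/H] := leP be al; rewrite distrC.
have pK : 0 < pi / K%:R :> R by rewrite divr_gt0// pi_gt0.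
have q0 : 0 <= (al - be) / (pi / K%:R) by rewrite divr_ge0 ?subr_ge0// ltW.
have /andP[] := truncn_itv q0; set j := Num.trunc _ => j1 j2.
rewrite ler_pdivlMr// in j1; rewrite ltr_pdivrMr// -natr1 mulrDl mul1r in j2.
rewrite -(proj_sum_shiftn be j).
rewrite (le_trans (proj_sum_lip _ _))// ger0_norm; last by lra.
rewrite mulrC -ler_pdivlMr//; lra.
Qed.

(** Since [1 <= |cos| + |sin|], the values at [al] and [al + pi / 2] add up to
    at least [K]. *)
Lemma proj_sum_ge al : (K%:R - pi) / 2 <= proj_sum al.
Proof.
have H : K%:R <= proj_sum al + proj_sum (al + pi / 2).
  rewrite /proj_sum -big_split/= -[leLHS]mulr1 mulr_natl.
  rewrite -[X in _ *+ X]card_ord -sumr_const; apply: ler_sum => k _.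
  rewrite opprD addrA cosBpihalf; set x := _ - al.
  have c1 := cos_max x; have s1 := sin_max x.
  rewrite -(cos2Dsin2 x) -(real_normK (num_real (cos x))) -(real_normK (num_real (sin x))).
  by rewrite !expr2 lerD// ler_piMl.
have := proj_sum_osc (al + pi / 2) al.
by move=> /(le_trans (ler_norm _)); lra.
Qed.

End Directions.

Lemma polar (a b : R) : exists al,
  a = Num.sqrt (a ^+ 2 + b ^+ 2) * cos al /\ b = Num.sqrt (a ^+ 2 + b ^+ 2) * sin al.
Proof.
set r := Num.sqrt _; have r2 : r ^+ 2 = a ^+ 2 + b ^+ 2.
  by rewrite sqr_sqrtr// addr_ge0// sqr_ge0.
have [r0|rn0] := eqVneq r 0.
  move: r2; rewrite r0 expr0n/= => /esym/eqP.
  rewrite paddr_eq0 ?sqr_ge0// !sqrf_eq0 => /andP[/eqP-> /eqP->].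
  by exists 0; rewrite !mul0r.
have rp : 0 < r by rewrite lt_neqAle eq_sym rn0 sqrtr_ge0.
have ar2 : (a / r) ^+ 2 + (b / r) ^+ 2 = 1.
  by rewrite !expr_div_n -mulrDl -r2 divff// expf_neq0.
have ar : -1 <= a / r <= 1.
  rewrite -ler_norml -(expr_le1 (n:=2))// real_normK ?num_real//.
  by rewrite -ar2 lerDl sqr_ge0.
have cE := acosK ar; have := sin_acos ar.
have -> : 1 - (a / r) ^+ 2 = (b / r) ^+ 2 by rewrite -ar2; ring.
rewrite sqrtr_sqr => sE.
have aE : a = r * (a / r) by rewrite mulrC divfK.
have bE : b = r * (b / r) by rewrite mulrC divfK.
have [b0|b0] := leP 0 (b / r).
  by exists (acos (a / r)); rewrite cE sE ger0_norm.
exists (- acos (a / r)); rewrite cosN sinN cE sE ltr0_norm// opprK.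
by split.
Qed.

(** The oscillation [pi] of [proj_sum] is negligible against its size, which is
    of order [K]. *)
Lemma modulus_approx (eta : R) : 0 < eta -> exists (K : nat) (c : R) (th : 'I_K -> R),
  0 < c /\ forall a b,
  c * Num.sqrt (a ^+ 2 + b ^+ 2) <= \sum_k `|cos (th k) * a + sin (th k) * b|
    <= (1 + eta) * c * Num.sqrt (a ^+ 2 + b ^+ 2).
Proof.
move=> eta0.
(* proj_sum 0 - pi >= (K - 3 * pi) / 2 >= (K - 12) / 2 > 8 / eta >= 2 * pi / eta *)
pose K := (Num.trunc (12 + 16 / eta)).+1.
have pi4 : pi <= 4 :> R.
  by have [/andP[_ pi2] _] := pihalf_02_cos_pihalf R; move: pi2; lra.
have pi0 := pi_gt0 R.
have e0 : 0 <= 16 / eta by rewrite divr_ge0// ltW.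
have KB : 12 + 16 / eta < K%:R.
  by have /andP[] := @truncn_itv R (12 + 16 / eta) (addr_ge0 (ler0n _ 12) e0).
have S0 := @proj_sum_ge K isT 0.
have c0 : 0 < proj_sum K 0 - pi by lra.
exists K, (proj_sum K 0 - pi), (fun k => k%:R * (pi / K%:R)); split => // a b.
have [al [aE bE]] := polar a b; set r := Num.sqrt _ in aE bE *.
have r0 : 0 <= r by exact: sqrtr_ge0.
have -> : \sum_(k < K) `|cos (k%:R * (pi / K%:R)) * a + sin (k%:R * (pi / K%:R)) * b|
    = proj_sum K al * r.
  rewrite /proj_sum mulr_suml; apply: eq_bigr => k _.
  rewrite {1}aE {1}bE -[in RHS](ger0_norm r0) -normrM cosB; congr (`|_|); ring.
have := @proj_sum_osc K isT al 0; rewrite ler_norml => /andP[osc1 osc2].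
apply/andP; split; first by rewrite ler_wpM2r//; lra.
rewrite ler_wpM2r// mulrDl mul1r.
have : 8 <= eta * (proj_sum K 0 - pi); last by lra.
rewrite mulrC -ler_pdivrMr//; lra.
Qed.

End Trigonometry.

(** * The upper bound in real and complex L_1 *)

Section Integrals.
Context {d : measure_display} {T : measurableType d} {R : realType}.
Variable mu : {measure set T -> \bar R}.

Lemma L1normE (g : T -> R) : L1norm mu g = Rintegral mu setT (fun t => `|g t|).
Proof. by rewrite /L1norm Lnorm1. Qed.

Lemma Rintegral_positive :
  positive_functional (fun g : T -> R => mu.-integrable setT (EFin \o g)) (Rintegral mu setT).
Proof.
split.
- exact: integrable0.
- move=> c f g fi gi.
  exact: (integrableD measurableT (integrableZl measurableT c fi) gi).
- by move=> f fi; exact: integrable_norm.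
- move=> c f g fi gi; rewrite RintegralD ?RintegralZl//.
  exact: (integrableZl measurableT c fi).
- by move=> f g fi gi fg; apply: le_Rintegral.
Qed.

End Integrals.

Lemma sum_positive (R : realType) (Om : Type) (J : finType)
    (E : (Om -> R) -> Prop) (I : (Om -> R) -> R) : positive_functional E I ->
  positive_functional (fun g : Om * J -> R => forall k, E (fun o => g (o, k)))
    (fun g => \sum_k I (fun o => g (o, k))).
Proof.
move=> IE; split.
- by move=> k; exact: (pf_dom0 IE).
- by move=> c f g Ef Eg k; exact: (pf_dom_lin IE).
- by move=> f Ef k; exact: (pf_dom_norm IE).
- move=> c f g Ef Eg; rewrite mulr_sumr -big_split/=.
  by apply: eq_bigr => k _; exact: (pf_lin IE).
- by move=> f g Ef Eg fg; apply: ler_sum => k _; exact: (pf_mono IE).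
Qed.

Section UpperBounds.
Variable R : realType.

Definition upper_const (p : R) (m n : nat) : R :=
  6 * m%:R * n%:R `^ Num.max (p^-1 - 2^-1) 0 + 9 / 4 * n%:R `^ p^-1.

Lemma upper_const_ge0 p m n : 0 <= upper_const p m n.
Proof. by rewrite addr_ge0// !mulr_ge0// powR_ge0. Qed.

Lemma mean_powR_scale (X : finType) (p c : R) (F G : X -> R) :
  0 <= p -> 0 <= c -> (forall x, 0 <= F x) -> (forall x, 0 <= G x) ->
  (forall x, F x <= c * G x) ->
  unif_mean (fun x => F x `^ p) <= c `^ p * unif_mean (fun x => G x `^ p).
Proof.
move=> p0 c0 F0 G0 FG; rewrite -meanZ; apply: le_mean => x; rewrite -powRM//.
by rewrite ge0_ler_powR ?nnegrE// mulr_ge0.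
Qed.

Lemma powR_root_le (p A S U : R) : 0 < p -> 0 <= A -> 0 <= S -> 0 <= U ->
  (A <= U `^ p * S) = (A `^ p^-1 <= U * S `^ p^-1).
Proof.
move=> p0 A0 S0 U0.
have pV x : 0 <= x -> (x `^ p^-1) `^ p = x.
  by move=> x0; rewrite -powRrM mulVf ?gt_eqF// powRr1.
have pV' x : 0 <= x -> (x `^ p) `^ p^-1 = x.
  by move=> x0; rewrite -powRrM divff ?gt_eqF// powRr1.
apply/idP/idP => H.
  have -> : U * S `^ p^-1 = (U `^ p * S) `^ p^-1 by rewrite powRM ?powR_ge0// pV'.
  by rewrite ge0_ler_powR ?nnegrE ?invr_ge0 ?(ltW p0)// mulr_ge0 ?powR_ge0.
have -> : U `^ p * S = (U * S `^ p^-1) `^ p by rewrite powRM ?powR_ge0// pV.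
by rewrite -[leLHS]pV// ge0_ler_powR ?nnegrE ?powR_ge0 ?(ltW p0)// mulr_ge0 ?powR_ge0.
Qed.

Lemma antipodal_sum_ge0 (V : zmodType) (N : V -> R) p m n (f : torus m n -> V) :
  0 <= antipodal_sum N p f.
Proof. by apply: sumr_ge0 => j _; apply: mean_ge0 => x; exact: powR_ge0. Qed.

Lemma sign_mean_ge0 (V : zmodType) (N : V -> R) p m n (f : torus m n -> V) :
  0 <= sign_mean N p f.
Proof. by apply: mean_ge0 => x; exact: powR_ge0. Qed.

Lemma real_cotype (p : R) (m n : nat) (d : measure_display) (T : measurableType d)
    (mu : {measure set T -> \bar R}) (f : torus m n -> T -> R) :
  1 <= p -> ~~ odd m -> (0 < n)%N -> (forall x, f x \in Lfun mu 1%E) ->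
  antipodal_sum (L1norm mu) p f <=
  upper_const p m n `^ p * sign_mean (L1norm mu) p f.
Proof.
move=> p1 m2 n0 f1.
have -> : L1norm mu = (fun g => Rintegral mu setT (fun t => `|g t|)).
  by apply/funext => g; exact: L1normE.
by apply: (abstract_cotype (Rintegral_positive mu)) => // x; apply/Lfun1_integrable.
Qed.

Section Complex.
Context {d : measure_display} {T : measurableType d}.
Variable mu : {measure set T -> \bar R}.

Lemma cmodulusE (g : T -> R[i]) t : cmodulus g t =
  Num.sqrt (complex.Re (g t) ^+ 2 + complex.Im (g t) ^+ 2).
Proof. by rewrite /cmodulus; case: (g t). Qed.

Lemma integrable_of_normr_le (g h : T -> R) : measurable_fun setT g ->
  mu.-integrable setT (EFin \o h) -> (forall t, `|g t| <= `|h t|) ->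
  mu.-integrable setT (EFin \o g).
Proof.
move=> mg ih gh; apply: (le_integrable _ _ _ ih) => //.
  exact/measurable_EFinP.
by move=> t _; rewrite lee_fin.
Qed.

Lemma CLfun1_integrable (g : T -> R[i]) : CLfun1 mu g ->
  mu.-integrable setT (EFin \o (fun t => complex.Re (g t))) /\
  mu.-integrable setT (EFin \o (fun t => complex.Im (g t))).
Proof.
move=> [mRe mIm fin].
have mm : measurable_fun setT (cmodulus g).
  have -> : cmodulus g = (fun t =>
      (complex.Re (g t) ^+ 2 + complex.Im (g t) ^+ 2) `^ 2^-1).
    by apply/funext => t; rewrite cmodulusE powR12_sqrt// addr_ge0// sqr_ge0.
  apply: (measurableT_comp (measurable_powR _)).
  by apply: measurable_funD; exact: measurable_funX.
have im : mu.-integrable setT (EFin \o cmodulus g).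
  apply/integrableP; split; first exact/measurable_EFinP.
  by move: fin; rewrite /finite_norm Lnorm1.
have ab (a b : R) : `|a| <= `|Num.sqrt (a ^+ 2 + b ^+ 2)|.
  rewrite [leRHS]ger0_norm ?sqrtr_ge0// -sqrtr_sqr ler_sqrt ?lerDl ?sqr_ge0//.
  by rewrite addr_ge0// sqr_ge0.
split; apply: integrable_of_normr_le im _ => // t; rewrite cmodulusE//.
by rewrite addrC.
Qed.

Lemma integrable_cmodulus (g : T -> R[i]) :
  mu.-integrable setT (EFin \o (fun t => complex.Re (g t))) ->
  mu.-integrable setT (EFin \o (fun t => complex.Im (g t))) ->
  mu.-integrable setT (EFin \o cmodulus g).
Proof.
move=> iRe iIm.
have mRe : measurable_fun setT (fun t => complex.Re (g t)).
  by apply/measurable_EFinP; case/integrableP: iRe.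
have mIm : measurable_fun setT (fun t => complex.Im (g t)).
  by apply/measurable_EFinP; case/integrableP: iIm.
apply: (@integrable_of_normr_le _
    (fun t => `|complex.Re (g t)| + `|complex.Im (g t)|)).
- have -> : cmodulus g = (fun t =>
      (complex.Re (g t) ^+ 2 + complex.Im (g t) ^+ 2) `^ 2^-1).
    by apply/funext => t; rewrite cmodulusE powR12_sqrt// addr_ge0// sqr_ge0.
  apply: (measurableT_comp (measurable_powR _)).
  by apply: measurable_funD; exact: measurable_funX.
- apply: (pf_domD (Rintegral_positive mu)); exact: integrable_norm.
- move=> t; rewrite cmodulusE ger0_norm ?sqrtr_ge0// [leRHS]ger0_norm ?addr_ge0//.
  rewrite -(ler_pXn2r (n:=2))// ?nnegrE ?addr_ge0// ?sqrtr_ge0//.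
  rewrite sqr_sqrtr ?addr_ge0 ?sqr_ge0// sqrrD !real_normK ?num_real//.
  by rewrite -addrA lerD2l addrC lerDl mulrn_wge0// mulr_ge0.
Qed.

Lemma CL1normE (g : T -> R[i]) :
  CL1norm mu g = Rintegral mu setT (cmodulus g).
Proof.
rewrite /CL1norm L1normE; congr Rintegral; apply/funext => t.
by rewrite cmodulusE ger0_norm// sqrtr_ge0.
Qed.

(** With [N] the norm obtained from the approximation of the modulus by [K]
    linear forms, the inequality for [N] gives the one for the complex norm
    with the additional factor [1 + eta]; then [eta] tends to 0. *)
Lemma complex_cotype (p : R) (m n : nat) (f : torus m n -> T -> R[i]) :
  1 <= p -> ~~ odd m -> (0 < n)%N -> (forall x, CLfun1 mu (f x)) ->
  antipodal_sum (CL1norm mu) p f <=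
  upper_const p m n `^ p * sign_mean (CL1norm mu) p f.
Proof.
move=> p1 m2 n0 f1; have p0 : 0 < p by lra.
have fRe x := (CLfun1_integrable (f1 x)).1.
have fIm x := (CLfun1_integrable (f1 x)).2.
have IE := Rintegral_positive mu.
have U0 := upper_const_ge0 p m n; set U := upper_const p m n in U0 *.
have ReB x y : (fun t => complex.Re ((f x - f y) t)) =
    (fun t => complex.Re (f x t) - complex.Re (f y t)).
  by apply/funext => t; rewrite -[(f x - f y) t]/(f x t - f y t) raddfB.
have ImB x y : (fun t => complex.Im ((f x - f y) t)) =
    (fun t => complex.Im (f x t) - complex.Im (f y t)).
  by apply/funext => t; rewrite -[(f x - f y) t]/(f x t - f y t) raddfB.
have im x y : mu.-integrable setT (EFin \o cmodulus (f x - f y)).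
  apply: integrable_cmodulus; rewrite ?ReB ?ImB; exact: (pf_domB IE).
have CN0 x y : 0 <= CL1norm mu (f x - f y).
  rewrite CL1normE; apply: (pf_ge0 IE) => // t.
  by rewrite cmodulusE sqrtr_ge0.
rewrite powR_root_le ?antipodal_sum_ge0 ?sign_mean_ge0//.
set A := antipodal_sum _ _ _ `^ _; set S := sign_mean _ _ _ `^ _.
have S0 : 0 <= S by exact: powR_ge0.
suff H eta : 0 < eta -> A <= (1 + eta) * (U * S).
  apply/ler_addgt0Pr => e e0.
  have US : 0 <= U * S by exact: mulr_ge0.
  have US1 : 0 < U * S + 1 by lra.
  rewrite (le_trans (H (e / (U * S + 1)) _)) ?divr_gt0// mulrDl mul1r lerD2l.
  by rewrite -mulrA ler_piMr ?(ltW e0)// ler_pdivrMl// mulr1; lra.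
move=> eta0; rewrite mulrA -powR_root_le ?antipodal_sum_ge0 ?sign_mean_ge0//; last first.
  by rewrite mulr_ge0//; lra.
have [K [c [th [c0 thP]]]] := modulus_approx eta0.
pose g x (tk : T * 'I_K) := cos (th tk.2) * complex.Re (f x tk.1)
  + sin (th tk.2) * complex.Im (f x tk.1).
pose N (h : T * 'I_K -> R) := \sum_k Rintegral mu setT (fun t => `|h (t, k)|).
have gi x k : mu.-integrable setT (EFin \o (fun t => g x (t, k))).
  exact: (pf_domD IE (pf_domZ IE (cos (th k)) (fRe x)) (pf_domZ IE (sin (th k)) (fIm x))).
have gdi x y k : mu.-integrable setT (EFin \o (fun t => `|(g x - g y) (t, k)|)).
  by apply: (pf_dom_norm IE (f := fun t => (g x - g y) (t, k))); exact: (pf_domB IE).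
have NE x y : N (g x - g y) = Rintegral mu setT (fun t =>
    \sum_k `|cos (th k) * complex.Re ((f x - f y) t) +
             sin (th k) * complex.Im ((f x - f y) t)|).
  rewrite /N -(pf_sum IE)//; congr Rintegral; apply/funext => t.
  apply: eq_bigr => k _; congr (`|_|).
  have /(congr1 (@^~ t)) /= -> := ReB x y; have /(congr1 (@^~ t)) /= -> := ImB x y.
  by rewrite -[(g x - g y) (t, k)]/(g x (t, k) - g y (t, k)) /g /=; ring.
have si x y : mu.-integrable setT (EFin \o (fun t =>
    \sum_k `|cos (th k) * complex.Re ((f x - f y) t) +
             sin (th k) * complex.Im ((f x - f y) t)|)).
  apply: (pf_dom_sum IE) => k; apply: (pf_dom_norm IE).
  by apply: (pf_domD IE); apply: (pf_domZ IE); rewrite ?ReB ?ImB; exact: (pf_domB IE).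
have N1 x y : CL1norm mu (f x - f y) <= c^-1 * N (g x - g y).
  rewrite ler_pdivlMl// CL1normE NE -(pfZ IE)//.
  apply: (pf_mono IE) => //; first exact: (pf_domZ IE).
  move=> t; rewrite cmodulusE.
  by case/andP: (thP (complex.Re ((f x - f y) t)) (complex.Im ((f x - f y) t))).
have N2 x y : N (g x - g y) <= ((1 + eta) * c) * CL1norm mu (f x - f y).
  rewrite CL1normE NE -(pfZ IE)//.
  apply: (pf_mono IE) => //; first exact: (pf_domZ IE).
  move=> t; rewrite cmodulusE.
  by case/andP: (thP (complex.Re ((f x - f y) t)) (complex.Im ((f x - f y) t))).
have NN0 x y : 0 <= N (g x - g y).
  by apply: sumr_ge0 => k _; apply: (pf_ge0 IE).
have c0' : 0 <= c^-1 by rewrite invr_ge0 ltW.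
have e1 : 0 <= 1 + eta by lra.
have ec0 : 0 <= (1 + eta) * c by rewrite mulr_ge0// ltW.
apply: (@le_trans _ _ (c^-1 `^ p * antipodal_sum N p g)).
  rewrite mulr_sumr; apply: ler_sum => j _.
  by apply: mean_powR_scale => //; exact: ltW.
apply: (@le_trans _ _ (c^-1 `^ p * (U `^ p * sign_mean N p g))).
  rewrite ler_wpM2l ?powR_ge0//.
  by apply: (abstract_cotype (sum_positive _ IE)).
apply: (@le_trans _ _ (c^-1 `^ p * (U `^ p *
    (((1 + eta) * c) `^ p * sign_mean (CL1norm mu) p f)))).
  rewrite !ler_wpM2l ?powR_ge0//.
  by apply: mean_powR_scale => //; exact: ltW.
rewrite (_ : (1 + eta) * U = c^-1 * (U * ((1 + eta) * c))).
  by rewrite (powRM _ c0' (mulr_ge0 U0 ec0)) (powRM _ U0 ec0) !mulrA.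
by field; rewrite gt_eqF.
Qed.

End Complex.

End UpperBounds.

(** * Finitely supported measures *)

Section FiniteExamples.
Variable R : realType.
Local Notation normc := ComplexField.Normc.normc.

Definition l1norm (X : finType) (g : X -> R[i]) : R := \sum_s normc (g s).

Definition count_below (K : nat) : {measure set nat -> \bar R} :=
  msum (fun k => \d_k) K.

Lemma integral_count_below (K : nat) (g : nat -> R) : (forall k, 0 <= g k) ->
  (\int[count_below K]_x (g x)%:E)%E = (\sum_(k < K) g k)%:E.
Proof.
move=> g0; rewrite ge0_integral_measure_sum//; last first.
  by move=> x _; rewrite lee_fin.
rewrite -sumEFin; apply: eq_bigr => k _.
by rewrite integral_dirac// diracT mul1e.
Qed.

Lemma normc_ge0 (z : R[i]) : 0 <= normc z.
Proof. by case: z => a b; exact: sqrtr_ge0. Qed.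

Lemma count_below_L1 (K : nat) (g : nat -> R[i]) :
  CLfun1 (count_below K) g /\
  CL1norm (count_below K) g = \sum_(k < K) normc (g k).
Proof.
have H : ('N[count_below K]_1[EFin \o cmodulus g] = (\sum_(k < K) normc (g k))%:E)%E.
  rewrite Lnorm1 -(integral_count_below K (g := fun k => normc (g k))).
    2: by move=> k; exact: normc_ge0.
  by apply: eq_integral => k _; rewrite /= ger0_norm ?normc_ge0.
split; last by rewrite /CL1norm /L1norm H.
by split => //; rewrite /finite_norm H ltry.
Qed.

(** Points of [X] are enumerated as natural numbers because every function on
    [nat] is measurable.  The denominator cannot vanish: by the upper bound the
    numerator would vanish too. *)
Lemma le_cotype_const (X : finType) (x0 : X) (p A0 S0 : R) (m n : nat)
    (F : torus m n -> X -> R[i]) :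
  1 <= p -> ~~ odd m -> (0 < n)%N -> 0 < A0 ->
  A0 <= antipodal_sum (@l1norm X) p F -> sign_mean (@l1norm X) p F <= S0 ->
  ((A0 / S0)%:E <= cotype_const_L1 p m n)%E.
Proof.
move=> p1 m2 n0 A00 AA SS.
pose f (x : torus m n) (k : nat) : R[i] := F x (nth x0 (enum X) k).
pose mu := count_below #|X|.
have NE x y : CL1norm mu (f x - f y) = l1norm (F x - F y).
  rewrite (count_below_L1 _ _).2 /l1norm -[RHS]big_enum (big_nth x0) -cardE.
  by rewrite big_mkord.
have f1 x : CLfun1 mu (f x) by exact: (count_below_L1 _ _).1.
have AE : antipodal_sum (CL1norm mu) p f = antipodal_sum (@l1norm X) p F.
  by apply: eq_bigr => j _; apply: eq_mean => x; rewrite NE.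
have SE : sign_mean (CL1norm mu) p f = sign_mean (@l1norm X) p F.
  by apply: eq_mean => x; rewrite NE.
have Sn0 : sign_mean (CL1norm mu) p f != 0.
  apply/eqP => S00; have := complex_cotype p1 m2 n0 f1.
  by rewrite S00 mulr0 AE => /(lt_le_trans (lt_le_trans A00 AA)); rewrite ltxx.
have Sp : 0 < sign_mean (@l1norm X) p F.
  by rewrite -SE lt_neqAle eq_sym Sn0 sign_mean_ge0.
apply: (@le_trans _ _ (antipodal_sum (CL1norm mu) p f / sign_mean (CL1norm mu) p f)%:E).
  rewrite lee_fin AE SE ler_pM ?(ltW A00) ?invr_ge0 ?(le_trans (ltW Sp) SS)//.
  by rewrite lef_pV2 ?posrE// (lt_le_trans Sp).
apply: ereal_sup_ubound; right.
by exists default_measure_display, nat, mu, f.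
Qed.

End FiniteExamples.

(** * Two extremal maps *)

Section PointMass.
Variables (R : realType) (p : R) (m n : nat).
Hypotheses (p1 : 1 <= p) (m4 : (4 <= m)%N) (m2 : ~~ odd m) (n0 : (0 < n)%N).
Local Notation normc := ComplexField.Normc.normc.

Let m1 : (1 < m)%N. Proof. exact: leq_trans m4. Qed.

Lemma half_neq0 : (m./2)%:R != 0 :> 'Z_m.
Proof.
rewrite -val_eqE /= val_Zp_nat// modn_small.
  by rewrite -lt0n half_gt0 (leq_trans _ m4).
by rewrite ltn_half_double -addnn -{1}[m]addn0 ltn_add2l ltnW.
Qed.

Definition point_mass (x : torus m n) (_ : unit) : R[i] := (x == 0)%:R.

Let Nbool (a b : bool) (h : unit -> R[i]) : h tt = a%:R - b%:R ->
  l1norm h `^ p = (a (+) b)%:R.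
Proof.
move=> hE; rewrite /l1norm (big_pred1 tt); last by case.
have pn0 : p != 0 := lt0r_neq0 (lt_le_trans ltr01 p1).
rewrite hE; case: a b {hE} => [] [] /=; rewrite ?subrr ?subr0 ?sub0r ?sqrrN
  ?expr1n ?expr0n /= ?addr0 ?sqrtr1 ?sqrtr0 ?powR1 ?powR0//.
Qed.

Let G := torus m n.

Let delta : R := unif_mean (fun x : G => (x == 0)%:R).

Let delta_gt0 : 0 < delta.
Proof.
rewrite /delta /unif_mean (bigD1 0)//= eqxx big1 ?addr0.
  by rewrite divr_gt0// ltr0n; apply/card_gt0P; exists 0.
by move=> x /negbTE->.
Qed.

Lemma antipodal_point_mass :
  antipodal_sum (@l1norm R unit) p point_mass = n%:R * (2 * delta).
Proof.
rewrite /antipodal_sum (eq_bigr (fun=> 2 * delta)); last first.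
  move=> j _.
  have h0 : half_shift m j != 0.
    apply/eqP => /rowP/(_ j)/eqP; rewrite !mxE !eqxx mulr1.
    by apply/negP; exact: half_neq0.
  rewrite (eq_mean (G := fun x => (x + half_shift m j == 0)%:R + (x == 0)%:R)).
    by rewrite meanD (mean_translate (fun x => (x == 0)%:R)) mulr2n mulrDl mul1r.
  move=> x; rewrite (@Nbool (x + half_shift m j == 0) (x == 0))//.
  have [->|xn0] := eqVneq x 0; first by rewrite add0r (negbTE h0) add0r.
  by rewrite addbF addr0.
by rewrite sumr_const card_ord [RHS]mulr_natl.
Qed.

Lemma sign_mean_point_mass : sign_mean (@l1norm R unit) p point_mass <= 2 * delta.
Proof.
have c0 := card_cube n.
have -> : 2 * delta = unif_mean (fun xe : G * {ffun 'I_n -> 'I_3} =>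
    (xe.1 + sign_shift m xe.2 == 0)%:R + (xe.1 == 0)%:R).
  rewrite meanD mulr2n mulrDl mul1r; congr (_ + _).
    rewrite -(@mean_reindex _ _ _ (fun xe : G * {ffun 'I_n -> 'I_3} =>
      (xe.1 - sign_shift m xe.2, xe.2))).
      rewrite mean_pair; apply: eq_mean => x.
      by under eq_mean do rewrite /= subrK; rewrite mean_cst.
    by exists (fun xe => (xe.1 + sign_shift m xe.2, xe.2)) => -[x e];
      rewrite /= ?addrK ?subrK.
  by rewrite mean_pair; apply: eq_mean => x /=; rewrite mean_cst.
apply: le_mean => -[x e] /=.
rewrite (@Nbool (x + sign_shift m e == 0) (x == 0))//.
by rewrite -natrD ler_nat; case: (_ == 0); case: (_ == 0).
Qed.

(** A translation moves the point mass off itself or fixes it, so an increment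
    has mean [2 * delta] or 0; all antipodal shifts are of the first kind. *)
Lemma le_cotype_const_point_mass : (n%:R%:E <= cotype_const_L1 p m n :> \bar R)%E.
Proof.
have A0 : 0 < n%:R * (2 * delta).
  by apply: mulr_gt0; rewrite ?ltr0n// mulr_gt0.
have d2 : 2 * delta != 0 by rewrite mulf_neq0// lt0r_neq0.
apply: le_trans (le_cotype_const tt p1 m2 n0 A0 _ sign_mean_point_mass).
  by rewrite mulfK.
by rewrite antipodal_point_mass.
Qed.

End PointMass.

Section RademacherCharacters.
Variables (R : realType) (m n : nat).
Hypotheses (m4 : (4 <= m)%N) (m2 : ~~ odd m).
Local Notation normc := ComplexField.Normc.normc.
Local Notation signs := {ffun 'I_n -> bool}.

Let m1 : (1 < m)%N. Proof. exact: leq_trans m4. Qed.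

Lemma card_signs : (0 < #|{: signs}|)%N.
Proof. by apply/card_gt0P; exists [ffun=> true]. Qed.

Let r (j : 'I_n) (s : signs) : R := (-1) ^+ s j.

Let mean_rr i j : unif_mean (fun s => r i s * r j s) = (i == j)%:R.
Proof.
case: eqVneq => [->|ij].
  rewrite -(mean_cst 1 card_signs); apply: eq_mean => s.
  by rewrite /r -expr2 sqrr_sign.
pose fl (s : signs) : signs := [ffun k => if k == i then ~~ s k else s k].
have flK : involutive fl.
  by move=> s; apply/ffunP => k; rewrite !ffunE; case: eqP => // _; rewrite negbK.
have := @mean_reindex R _ _ fl (fun s => r i s * r j s) (inv_bij flK).
rewrite (eq_mean (G := fun s => (-1) * (r i s * r j s))) ?meanZ ?mulr0n; first by lra.
move=> s; rewrite /r /= !ffunE eqxx eq_sym (negbTE ij).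
by rewrite signrN; ring.
Qed.

Let mean_sqr_real (a : 'I_n -> R) :
  unif_mean (fun s => (\sum_j r j s * a j) ^+ 2) = \sum_j a j ^+ 2.
Proof.
rewrite (eq_mean (G := fun s => \sum_i \sum_j (a i * a j) * (r i s * r j s))).
  rewrite mean_sum; apply: eq_bigr => i _; rewrite mean_sum (bigD1 i)//= big1.
    by rewrite meanZ mean_rr eqxx mulr1 addr0 expr2.
  by move=> j ji; rewrite meanZ mean_rr eq_sym (negbTE ji) mulr0.
move=> s; rewrite expr2 mulr_suml; apply: eq_bigr => i _.
by rewrite mulr_sumr; apply: eq_bigr => j _; ring.
Qed.

Lemma normcE (z : R[i]) : normc z ^+ 2 = complex.Re z ^+ 2 + complex.Im z ^+ 2.
Proof. by case: z => a b /=; rewrite sqr_sqrtr// addr_ge0// sqr_ge0. Qed.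

(** Half of Khintchine's inequality: the [L_1] mean is below the [L_2] mean,
    where the independent signs are orthonormal. *)
Lemma mean_rademacher_le (z : 'I_n -> R[i]) (D : R) : 0 <= D ->
  \sum_j normc (z j) ^+ 2 <= D ^+ 2 ->
  unif_mean (fun s : signs => normc (\sum_j (-1) ^+ s j * z j)) <= D.
Proof.
move=> D0 zD; set M := unif_mean _.
have M0 : 0 <= M by apply: mean_ge0 => s; exact: normc_ge0.
rewrite -(ler_pXn2r (n:=2))// ?nnegrE// (le_trans _ zD)//.
have := @powR_mean R signs 2 (fun s : signs => normc (\sum_j (-1) ^+ s j * z j)) _ card_signs
  (fun=> normc_ge0 _).
rewrite ler1n => /(_ isT); rewrite powR_mulrn// => /le_trans; apply.
rewrite (eq_mean (G := fun s => (\sum_j r j s * complex.Re (z j)) ^+ 2 +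
    (\sum_j r j s * complex.Im (z j)) ^+ 2)).
  rewrite meanD !mean_sqr_real -big_split/= le_eqVlt; apply/orP; left; apply/eqP.
  by apply: eq_bigr => j _; rewrite normcE.
move=> s; rewrite powR_mulrn ?normc_ge0// normcE !raddf_sum.
congr (_ ^+ 2 + _ ^+ 2); apply: eq_bigr => j _; rewrite /r;
  by case: (s j); rewrite ?expr0 ?expr1 ?mul1r ?mulN1r ?raddfN.
Qed.

Let th : R := 2 * pi / m%:R.

Let u : R[i] := (cos th +i* sin th)%C.

Let uX k : u ^+ k = (cos (k%:R * th) +i* sin (k%:R * th))%C.
Proof.
elim: k => [|k IH]; first by rewrite expr0 mul0r cos0 sin0.
rewrite exprS IH -natr1 mulrDl mul1r [_ + th]addrC cosD sinD.
by rewrite /u; apply/eqP; rewrite eq_complex /=; apply/andP; split; apply/eqP; ring.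
Qed.

Let mR : 0 < m%:R :> R. Proof. by rewrite ltr0n (leq_trans _ m4). Qed.

Let um : u ^+ m = 1.
Proof.
rewrite uX (_ : _ * th = pi *+ 2); first by rewrite cos2pi sin2pi.
by rewrite /th -mulr_natl; field; rewrite gt_eqF.
Qed.

Let um2 : u ^+ m./2 = -1.
Proof.
rewrite uX (_ : _ * th = pi).
  by rewrite cospi sinpi; apply/eqP; rewrite eq_complex /= oppr0 !eqxx.
have mE : m%:R = (m./2)%:R * 2%:R :> R by rewrite -natrM muln2 even_halfK.
have h0 : (m./2)%:R != 0 :> R.
  by rewrite pnatr_eq0 -lt0n half_gt0 (leq_trans _ m4).
by rewrite /th mE; field.
Qed.

(** The character [z |-> exp (2 i pi z / m)]. *)
Definition character (z : 'Z_m) : R[i] := u ^+ (z : nat).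

Lemma characterD (y z : 'Z_m) : character (y + z) = character y * character z.
Proof.
rewrite /character -exprD -[RHS](expr_mod _ um).
by congr (_ ^+ _); congr (_ %% _)%N; exact: Zp_cast.
Qed.

Lemma character_nat k : character k%:R = u ^+ k.
Proof. by rewrite /character val_Zp_nat// -(expr_mod k um). Qed.

Lemma norm_character z : normc (character z) = 1.
Proof.
rewrite /character uX; apply/eqP; rewrite -(eqrXn2 (n:=2)) ?normc_ge0//.
by rewrite normcE /= cos2Dsin2 expr1n.
Qed.

Let norm_um1 : normc (u - 1) <= 2 * pi / m%:R.
Proof.
have t0 : 0 <= th by rewrite divr_ge0 ?mulr_ge0 ?pi_ge0// ltW.
rewrite -/th -(ler_pXn2r (n:=2))// ?nnegrE ?normc_ge0// normcE /=.
have hs : sin (th / 2) ^+ 2 <= (th / 2) ^+ 2.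
  rewrite -(real_normK (num_real (sin _))) -[leRHS](real_normK (num_real _)).
  by rewrite ler_pXn2r ?nnegrE//; exact: norm_sin_le.
have thE : th = (th / 2) *+ 2 by rewrite -mulr_natr divfK.
have c1 : cos th = 1 - 2 * sin (th / 2) ^+ 2.
  by rewrite {1}thE cos_mulr2n cos2sin2 -mulr_natl; ring.
have c2 := cos2Dsin2 th.
rewrite subr0; move: hs; rewrite expr_div_n; lra.
Qed.

Lemma norm_character_sign (k : 'I_3) :
  normc (character (k%:R - 1) - 1) <= 2 * pi / m%:R.
Proof.
have ch1 : character 1 = u by rewrite -[1]/(1%:R) character_nat expr1.
have ch0 : character 0 = 1 by rewrite -[0]/(0%:R) character_nat expr0.
case: k => -[|[|[|//]]] /= _.
- rewrite sub0r.
  have E : character (-1) * u = 1 by rewrite -ch1 -characterD addNr.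
  rewrite (_ : _ - 1 = character (-1) * (- (u - 1))).
    by rewrite ComplexField.Normc.normcM norm_character mul1r normcN.
  by rewrite opprB mulrBr mulr1 E.
- by rewrite subrr ch0 subrr ComplexField.Normc.normc0 divr_ge0 ?mulr_ge0 ?pi_ge0// ltW.
- by rewrite mulr2n addrK ch1.
Qed.

(** The Rademacher functions span a copy of [l_2] in [L_1], in which the [j]-th
    circle of the torus is placed along the [j]-th basis vector. *)
Definition rademacher_map (J : {set 'I_n}) (x : torus m n) (s : signs) : R[i] :=
  \sum_(j in J) (-1) ^+ s j * character (x 0 j).

Section Evaluate.
Variables (J : {set 'I_n}) (p : R).
Hypothesis p1 : 1 <= p.
Let C : R := #|{: signs}|%:R.

Let C0 : 0 < C. Proof. by rewrite ltr0n card_signs. Qed.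
Let p0 : 0 < p. Proof. exact: lt_le_trans p1. Qed.

Lemma antipodal_rademacher_map :
  #|J|%:R * (2 * C) `^ p <= antipodal_sum (@l1norm R signs) p (rademacher_map J).
Proof.
rewrite /antipodal_sum.
apply: (@le_trans _ _ (\sum_(j in J) (2 * C) `^ p)).
  by rewrite sumr_const mulr_natl.
rewrite big_mkcond/=; apply: ler_sum => j _.
case: ifPn => [jJ|_]; last by apply: mean_ge0 => x; exact: powR_ge0.
have G0 : (0 < #|{: torus m n}|)%N by apply/card_gt0P; exists 0.
rewrite -[leLHS](mean_cst _ G0); apply: le_mean => x.
rewrite le_eqVlt; apply/orP; left; apply/eqP; congr (_ `^ _).
rewrite /l1norm (eq_bigr (fun=> 2)); first by rewrite sumr_const /C [LHS]mulr_natr.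
move=> s _; rewrite -[(_ - _) s]/(rademacher_map J (x + half_shift m j) s -
  rademacher_map J x s).
rewrite /rademacher_map -sumrB (bigD1 j)//= big1 ?addr0 => [|k /andP[_ kj]].
  rewrite !mxE !eqxx mulr1 characterD character_nat um2 mulrN1.
  rewrite (_ : _ - _ = - 2 * ((-1) ^+ s j * character (x 0 j))); last by ring.
  rewrite !ComplexField.Normc.normcM norm_character.
  have -> : normc ((-1) ^+ s j) = 1 :> R.
    by case: (s j); rewrite ?expr0 ?expr1 ?normcN ComplexField.Normc.normc1.
  rewrite !mulr1 /= ?addr0 ?oppr0 expr0n addr0.
  by rewrite sqrtr_sqr normrN ger0_norm.
by rewrite !mxE (negbTE kj) andbF mulr0 addr0 subrr.
Qed.

Lemma sign_mean_rademacher_map :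
  sign_mean (@l1norm R signs) p (rademacher_map J) <=
  (C * (2 * pi / m%:R * Num.sqrt #|J|%:R)) `^ p.
Proof.
have D0 : 0 <= 2 * pi / m%:R * Num.sqrt #|J|%:R :> R.
  by rewrite mulr_ge0 ?sqrtr_ge0// divr_ge0 ?mulr_ge0 ?pi_ge0// ltW.
have G0 : (0 < #|{: torus m n * {ffun 'I_n -> 'I_3}}|)%N.
  by rewrite card_prod muln_gt0 card_cube andbT; apply/card_gt0P; exists 0.
rewrite -[leRHS](mean_cst _ G0); apply: le_mean => -[x e] /=.
rewrite ge0_ler_powR ?nnegrE ?(ltW p0)//.
- by apply: sumr_ge0 => s _; exact: normc_ge0.
- by rewrite mulr_ge0// ltW.
rewrite /l1norm sum_unif_mean ?card_signs// ler_wpM2l ?(ltW C0)//.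
pose z (j : 'I_n) : R[i] := if j \in J then
  character (x 0 j) * (character ((e j : nat)%:R - 1) - 1) else 0.
rewrite (eq_mean (G := fun s : signs => normc (\sum_j (-1) ^+ s j * z j))).
  apply: mean_rademacher_le => //.
  rewrite exprMn sqr_sqrtr// mulr_natr -sumr_const.
  rewrite big_mkcond [leRHS]big_mkcond/=; apply: ler_sum => j _.
  rewrite /z; case: ifP => _; last by rewrite ComplexField.Normc.normc0 expr0n.
  rewrite ComplexField.Normc.normcM norm_character mul1r.
  rewrite ler_pXn2r ?nnegrE ?normc_ge0 ?norm_character_sign//.
  by rewrite divr_ge0 ?mulr_ge0 ?pi_ge0// ltW.
move=> s; congr normc.
rewrite -[(_ - _) s]/(rademacher_map J (x + sign_shift m e) s - rademacher_map J x s).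
rewrite /rademacher_map -sumrB big_mkcond/=; apply: eq_bigr => j _.
rewrite /z; case: ifP => _; last by rewrite mulr0.
by rewrite !mxE characterD; ring.
Qed.

Lemma le_cotype_const_rademacher : (0 < n)%N -> (0 < #|J|)%N ->
  (((m%:R / pi) `^ p * #|J|%:R `^ (1 - p / 2))%:E <= cotype_const_L1 p m n)%E.
Proof.
move=> n0 J0; have JR : 0 < #|J|%:R :> R by rewrite ltr0n.
have A0 : 0 < #|J|%:R * (2 * C) `^ p by rewrite mulr_gt0// powR_gt0// mulr_gt0.
apply: le_trans (le_cotype_const [ffun=> true] p1 m2 n0 A0
  antipodal_rademacher_map sign_mean_rademacher_map).
rewrite lee_fin le_eqVlt; apply/orP; left; apply/eqP.
have pi0 := pi_gt0 R.
have mp0 : 0 <= m%:R / pi :> R by rewrite divr_ge0// ltW.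
have sJ : 0 < Num.sqrt #|J|%:R :> R by rewrite sqrtr_gt0.
rewrite -[RHS]mulrA -[in RHS](powR12_sqrt (ltW JR)).
have -> : 2 * C = (C * (2 * pi / m%:R * #|J|%:R `^ 2^-1)) * (m%:R / pi * #|J|%:R `^ (- 2^-1)).
  have aux (c t k q : R) : t != 0 -> k != 0 -> q != 0 ->
      2 * c = (c * (2 * t / k * q)) * (k / t * q^-1).
    by move=> t0 k0 q0; field; rewrite t0 k0 q0.
  by rewrite powRN; apply: aux; rewrite lt0r_neq0// powR_gt0.
set D := C * _.
have D0 : 0 < D.
  by rewrite mulr_gt0// mulr_gt0 ?powR_gt0// divr_gt0// mulr_gt0.
rewrite (powRM _ (ltW D0) (mulr_ge0 mp0 (powR_ge0 _ _))).
rewrite (powRM _ mp0 (powR_ge0 _ _)) -powRrM.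
have Dp : D `^ p != 0 by rewrite gt_eqF// powR_gt0.
have -> : #|J|%:R `^ (1 - p / 2) = #|J|%:R * #|J|%:R `^ (- 2^-1 * p) :> R.
  rewrite -{2}(powRr1 (ltW JR)) -powRD; first by congr (_ `^ _); field.
  by apply/implyP => _; rewrite gt_eqF.
by field.
Qed.

End Evaluate.

End RademacherCharacters.

(** Each of the two maps accounts for one term of the sum; the maximum of two
    numbers is at least half their sum, and the spare factor [2 ^ p >= 2] of
    the constant absorbs this. *)
Lemma cotype_const_ge (R : realType) (p : R) (m n : nat) :
  1 <= p -> (4 <= m)%N -> ~~ odd m -> (0 < n)%N ->
  (((m%:R `^ p * n%:R `^ Num.max (1 - p / 2) 0 + n%:R) / (2 * pi) `^ p)%:E
   <= cotype_const_L1 p m n)%E.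
Proof.
move=> p1 m4 m2 n0; have pi0 := pi_gt0 R; have pi2 := pi_ge2 R.
set e := n%:R `^ _.
have e0 : 0 <= e by exact: powR_ge0.
have H1 : ((n%:R : R)%:E <= cotype_const_L1 p m n)%E.
  exact: le_cotype_const_point_mass.
have H2 : (((m%:R / pi) `^ p * e)%:E <= cotype_const_L1 p m n)%E.
  have := @le_cotype_const_rademacher R m n m4 m2.
  rewrite /e; case: (leP p 2) => p2 H.
    rewrite max_l; last by lra.
    by have := H [set: 'I_n]%SET p p1 n0; rewrite cardsT card_ord => /(_ n0).
  rewrite max_r; last by lra.
  by have := H [set Ordinal n0]%SET p p1 n0; rewrite cards1 powR1 powRr0 => /(_ isT).
have two : 2 <= 2 `^ p :> R.
  by rewrite -[leLHS]powRr1// ler_powR// ler1n.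
have twopi : 2 <= (2 * pi) `^ p :> R.
  rewrite (le_trans two)// ge0_ler_powR ?nnegrE//; lra.
have B1 : n%:R / (2 * pi) `^ p <= n%:R / 2 :> R.
  by rewrite ler_wpM2l// lef_pV2 ?posrE//; lra.
set X := (m%:R / pi) `^ p * e in H2.
have B2 : m%:R `^ p * e / (2 * pi) `^ p <= X / 2.
  have -> : m%:R `^ p = (m%:R / pi) `^ p * pi `^ p :> R.
    by rewrite -powRM ?divfK ?gt_eqF ?divr_ge0// ltW.
  have pp : 0 < pi `^ p :> R by rewrite powR_gt0.
  have tp : 0 < 2 `^ p :> R by rewrite powR_gt0.
  rewrite powRM ?(ltW pi0)//.
  have -> : (m%:R / pi) `^ p * pi `^ p * e / (2 `^ p * pi `^ p) = X / 2 `^ p :> R.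
    by rewrite /X; field; rewrite !gt_eqF.
  by rewrite ler_wpM2l ?mulr_ge0 ?powR_ge0// lef_pV2 ?posrE.
apply: (@le_trans _ _ (Num.max X n%:R)%:E).
  rewrite lee_fin mulrDl (le_trans (lerD B2 B1))//.
  have : X <= Num.max X n%:R by rewrite le_max lexx.
  have : n%:R <= Num.max X n%:R by rewrite le_max lexx orbT.
  lra.
by case: (leP X n%:R).
Qed.

(** * Comparison of the constants *)

(** Since [6 + 9 / 4 <= 11], the constant is at most [11] times the larger of
    its two scales. *)
Lemma upper_const_powR_le (R : realType) (p : R) (m n : nat) : 1 <= p ->
  upper_const p m n `^ p <=
  11 `^ p * (m%:R `^ p * n%:R `^ Num.max (1 - p / 2) 0 + n%:R).
Proof.
move=> p1; have p0 : 0 < p by lra.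
set a := n%:R `^ Num.max (p^-1 - 2^-1) 0; set b := n%:R `^ p^-1 : R.
have a0 : 0 <= m%:R * a by rewrite mulr_ge0// powR_ge0.
have b0 : 0 <= b by exact: powR_ge0.
have aE : (m%:R * a) `^ p = m%:R `^ p * n%:R `^ Num.max (1 - p / 2) 0.
  rewrite powRM ?powR_ge0// /a -powRrM maxr_pMl ?(ltW p0)// mul0r mulrBl.
  by rewrite mulVf ?gt_eqF// [2^-1 * p]mulrC.
have bE : b `^ p = n%:R by rewrite -powRrM mulVf ?gt_eqF// powRr1.
have M0 : 0 <= Num.max (m%:R * a) b by rewrite le_max a0.
have UM : upper_const p m n <= 11 * Num.max (m%:R * a) b.
  have : m%:R * a <= Num.max (m%:R * a) b by rewrite le_max lexx.
  have : b <= Num.max (m%:R * a) b by rewrite le_max lexx orbT.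
  by rewrite /upper_const -/a -/b -mulrA; lra.
apply: (@le_trans _ _ ((11 * Num.max (m%:R * a) b) `^ p)).
  by rewrite ge0_ler_powR ?nnegrE ?upper_const_ge0 ?(ltW p0)// mulr_ge0.
rewrite powRM// ler_wpM2l ?powR_ge0// -aE -[in leRHS]bE.
by case: (leP (m%:R * a) b) => _; rewrite ?lerDl ?lerDr powR_ge0.
Qed.

Lemma upper_const_le (R : realType) (p : R) (m n : nat) :
  upper_const p m n <=
  9 * Num.sqrt 210 / 16 * m%:R * n%:R `^ Num.max (p^-1 - 2^-1) 0
    + 9 / 4 * n%:R `^ p^-1.
Proof.
have s14 : 14 <= Num.sqrt 210 :> R.
  by rewrite -[leLHS]ger0_norm// -sqrtr_sqr ler_sqrt//; lra.
rewrite lerD2r ler_wpM2r ?powR_ge0// ler_wpM2r//; lra.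
Qed.

Theorem theorem1p1 (R : realType) (p : R) (m n : nat)
    (hp : 1 <= p) (hm : (4 <= m)%N) (hm2 : ~~ odd m) (hn : (1 <= n)%N) :
  let K : R :=
    9 * Num.sqrt 210 / 16 * m%:R * n%:R `^ Num.max (p^-1 - 2^-1) 0
    + 9 / 4 * n%:R `^ p^-1 in
  let B : R := m%:R `^ p * n%:R `^ Num.max (1 - p / 2) 0 + n%:R in
  [/\ forall (d : measure_display) (T : measurableType d)
        (mu : {measure set T -> \bar R}) (f : torus m n -> T -> R),
        (forall x, f x \in Lfun mu 1%E) ->
        antipodal_sum (L1norm mu) p f `^ p^-1
          <= K * sign_mean (L1norm mu) p f `^ p^-1,
      forall (d : measure_display) (T : measurableType d)
        (mu : {measure set T -> \bar R}) (f : torus m n -> T -> R[i]),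
        (forall x, CLfun1 mu (f x)) ->
        antipodal_sum (CL1norm mu) p f `^ p^-1
          <= K * sign_mean (CL1norm mu) p f `^ p^-1 &
      ((B / (2 * pi) `^ p)%:E <= cotype_const_L1 p m n
        <= (11 `^ p * B)%:E)%E].
Proof.
move=> K B; have p0 : 0 < p by lra.
have UK : upper_const p m n <= K by exact: upper_const_le.
have UB : upper_const p m n `^ p <= 11 `^ p * B by exact: upper_const_powR_le.
have weaken (A S : R) : 0 <= A -> 0 <= S -> A <= upper_const p m n `^ p * S ->
    A `^ p^-1 <= K * S `^ p^-1.
  move=> A0 S0; rewrite powR_root_le ?upper_const_ge0// => /le_trans; apply.
  by rewrite ler_wpM2r ?powR_ge0.
have ratio (A S : R) : 0 <= S -> S != 0 -> A <= upper_const p m n `^ p * S ->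
    A / S <= 11 `^ p * B.
  move=> S0 Sn0 AS; have Sp : 0 < S by rewrite lt_neqAle eq_sym Sn0.
  rewrite ler_pdivrMr//.
  by rewrite (le_trans AS)// ler_wpM2r.
split.
- move=> d T mu f f1; apply: weaken; rewrite ?antipodal_sum_ge0 ?sign_mean_ge0//.
  exact: real_cotype.
- move=> d T mu f f1; apply: weaken; rewrite ?antipodal_sum_ge0 ?sign_mean_ge0//.
  exact: complex_cotype.
apply/andP; split; first exact: cotype_const_ge.
apply: ub_ereal_sup => _ [] [d [T [mu [f [f1 S0 ->]]]]]; rewrite lee_fin;
  apply: ratio => //; rewrite ?sign_mean_ge0//.
- exact: real_cotype.
- exact: complex_cotype.
Qed.
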